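(* Let $m\ge 1$ and $1\le p<\infty$. Then $(\widetilde{S}^{m,p}, d_p)$ is the completion of $(\widetilde{S}^{m}, d_p)$.
   Context: $H$ is the Hausdorff metric on nonempty closed subsets of $\mathbb{R}^m$ (Euclidean distance): $H(A,B)=\max\{\sup_{a\in A}\inf_{b\in B}d(a,b),\ \sup_{b\in B}\inf_{a\in A}d(a,b)\}$ (possibly $+\infty$). A fuzzy set on $\mathbb{R}^m$ is a function $u:\mathbb{R}^m\to[0,1]$; its cuts are $[u]_\alpha=\{x: u(x)\ge\alpha\}$ for $\alpha\in(0,1]$ and $[u]_0=\overline{\{x: u(x)>0\}}$. $\widetilde{S}^{m}$ (general fuzzy star-shaped numbers) is the set of fuzzy sets $u$ that are normal ($u(x_0)=1$ for some $x_0$), upper semi-continuous, have $[u]_0$ bounded, and are such that for every $\alpha\in(0,1]$ there exists $x_\alpha\in[u]_\alpha$ such that for all $y\in[u]_\alpha$ the line segment $\overline{x_\alpha y}$ is contained in $[u]_\alpha$. $\widetilde{S}^{m,p}$ is defined in the same way, with the condition ''$[u]_0$ bounded'' replaced by $\left(\int_0^1 H([u]_\alpha,\{0\})^p\,d\alpha\right)^{1/p}<+\infty$, where $0$ is the origin; so $\widetilde{S}^m\subset\widetilde{S}^{m,p}$. The metric on both is $d_p(u,v)=\left(\int_0^1 H([u]_\alpha,[v]_\alpha)^p\,d\alpha\right)^{1/p}$. A metric space $Y$ is the completion of a subspace $X\subset Y$ if $Y$ is complete and $X$ is dense in $Y$. *)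

(* Defs.v *)
From HB Require Import structures.
From mathcomp Require Import all_boot all_order all_algebra.
From mathcomp Require Import all_classical all_reals all_analysis.

Set Implicit Arguments.
Unset Strict Implicit.
Unset Printing Implicit Defensive.

Import Order.TTheory GRing.Theory Num.Theory.
Import numFieldNormedType.Exports.

Local Open Scope classical_set_scope.
Local Open Scope ring_scope.

(** R^m is ['rV[R]_m]. The library norm on matrices is
    the sup norm, so the Euclidean distance is defined explicitly; both induce
    the library topology of ['rV[R]_m], which is used for closures and
    semicontinuity. *)

Definition edist (R : realType) (m : nat) (x y : 'rV[R]_m) : R :=
  Num.sqrt (\sum_(i < m) (x 0 i - y 0 i) ^+ 2).

Definition euclidean_bounded (R : realType) (m : nat) (A : set 'rV[R]_m) : Prop :=
  exists M : R, forall x, A x -> edist x 0 <= M.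

Definition line_segment (R : realType) (m : nat) (x y : 'rV[R]_m) :
    set 'rV[R]_m :=
  [set (1 - t) *: x + t *: y | t in `[(0 : R), 1]].

Definition hausdorff_dist (R : realType) (m : nat) (A B : set 'rV[R]_m) : \bar R :=
  maxe (ereal_sup [set ereal_inf [set (edist a b)%:E | b in B] | a in A])
       (ereal_sup [set ereal_inf [set (edist a b)%:E | a in A] | b in B]).

Definition fuzzy_set (R : realType) (m : nat) (u : 'rV[R]_m -> R) : Prop :=
  forall x, 0 <= u x <= 1.

Definition fuzzy_cut (R : realType) (m : nat) (u : 'rV[R]_m -> R) (a : R) :
    set 'rV[R]_m :=
  if a == 0 then closure [set x | 0 < u x] else [set x | a <= u x].

Definition normal_fuzzy (R : realType) (m : nat) (u : 'rV[R]_m -> R) : Prop :=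
  exists x0, u x0 = 1.

(** The library only has [lower_semicontinuous]. *)
Definition upper_semicontinuous (T : topologicalType) (R : realType)
    (f : T -> R) : Prop :=
  forall x (a : R), f x < a -> \forall y \near x, f y < a.

(** The centre of the star is allowed to depend on the level [a]. *)
Definition starshaped_cuts (R : realType) (m : nat) (u : 'rV[R]_m -> R) : Prop :=
  forall a : R, 0 < a <= 1 ->
    exists2 xa, fuzzy_cut u a xa &
      forall y, fuzzy_cut u a y -> line_segment xa y `<=` fuzzy_cut u a.

(** The integrand takes values in [\bar R]: at level 0 the Hausdorff distance may
    be infinite for unbounded supports. *)
Definition dp (R : realType) (m : nat) (p : R) (u v : 'rV[R]_m -> R) : \bar R :=
  (poweR (\int[@lebesgue_measure R]_(a in `[0%R : R, 1%R])
            poweR (hausdorff_dist (fuzzy_cut u a) (fuzzy_cut v a)) p) p^-1)%E.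

Definition fuzzy_star_Lp (R : realType) (m : nat) (p : R) (u : 'rV[R]_m -> R) :
    Prop :=
  (poweR (\int[@lebesgue_measure R]_(a in `[0%R : R, 1%R])
            poweR (hausdorff_dist (fuzzy_cut u a) [set 0%R]) p) p^-1 < +oo)%E.

Definition Sm (R : realType) (m : nat) : set ('rV[R]_m -> R) :=
  [set u | [/\ fuzzy_set u, normal_fuzzy u, upper_semicontinuous u,
               euclidean_bounded (fuzzy_cut u 0) & starshaped_cuts u]].

Definition Smp (R : realType) (m : nat) (p : R) : set ('rV[R]_m -> R) :=
  [set u | [/\ fuzzy_set u, normal_fuzzy u, upper_semicontinuous u,
               fuzzy_star_Lp p u & starshaped_cuts u]].

(** Metric-space notions for a subset [Y] of a type [T] and an extended
    real-valued [d], required to be finite on [Y]. *)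

Definition metric_on (R : realType) (T : Type) (d : T -> T -> \bar R)
    (Y : set T) : Prop :=
  [/\ forall x y, Y x -> Y y -> (0 <= d x y < +oo)%E,
      forall x y, Y x -> Y y -> d x y = 0%E <-> x = y,
      forall x y, Y x -> Y y -> d x y = d y x &
      forall x y z, Y x -> Y y -> Y z -> (d x z <= d x y + d y z)%E].

Definition cauchy_seq (R : realType) (T : Type) (d : T -> T -> \bar R)
    (s : nat -> T) : Prop :=
  forall e : R, 0 < e ->
    exists N : nat, forall i j : nat, (N <= i)%N -> (N <= j)%N ->
      (d (s i) (s j) < e%:E)%E.

Definition complete_on (R : realType) (T : Type) (d : T -> T -> \bar R)
    (Y : set T) : Prop :=
  forall s : nat -> T, (forall n, Y (s n)) -> cauchy_seq d s ->
    exists2 l, Y l & d (s n) l @[n --> \oo] --> 0%E.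

Definition dense_in (R : realType) (T : Type) (d : T -> T -> \bar R)
    (X Y : set T) : Prop :=
  forall y, Y y -> forall e : R, 0 < e -> exists2 x, X x & (d y x < e%:E)%E.

Definition is_completion (R : realType) (T : Type) (d : T -> T -> \bar R)
    (Y X : set T) : Prop :=
  [/\ metric_on d Y, X `<=` Y, complete_on d Y & dense_in d X Y].

(* Main.v *)
(** The map sending a level [a] to the Hausdorff distance of the [a]-cuts of two
    upper semicontinuous fuzzy sets is lower semicontinuous from the left, hence
    measurable, so [dp] is an [L^p] norm of it and Minkowski's inequality gives the
    triangle inequality. Membership in [Smp p] says that the distance to the
    indicator of the origin is finite.

    Density: cut [u] off below the level [1/n] and use dominated convergence.

    Completeness: along a subsequence whose consecutive distances decay like [4^-k],
    Borel-Cantelli makes the cuts at almost every level a Cauchy sequence for the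
    Hausdorff distance. By compactness of closed balls they converge to their
    Kuratowski upper limit [K b], which is closed, bounded and star-shaped. The limit
    fuzzy set [u] has [a]-cut the intersection of the [K b] over [0 < b < a]; this is
    again star-shaped, and differs from [K a] for at most countably many [a]. Fatou's
    lemma bounds the distance to [u]. *)

From mathcomp Require Import all_boot all_order all_algebra.
From mathcomp Require Import all_classical all_reals all_analysis.
From mathcomp Require Import measurable_realfun.
From mathcomp Require Import ring lra.
Require Import Defs.

Set Implicit Arguments.
Unset Strict Implicit.
Unset Printing Implicit Defensive.
Import Order.TTheory GRing.Theory Num.Theory.
Import numFieldNormedType.Exports.
Local Open Scope classical_set_scope.
Local Open Scope ring_scope.

(** * Euclidean distance: triangle inequality, induced topology, compact balls *)

Section euclidean_distance.
Context {R : realType} {m : nat}.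
Implicit Types (x y z : 'rV[R]_m) (a b : 'I_m -> R).

(** Expanding the nonnegative sum of the squares of [B * a i - C * b i] gives
    [0 <= B * (A * B - C ^+ 2)]. When [B = 0] every [b i] vanishes and so does [C]. *)
Lemma cauchy_schwarz_sum a b :
  (\sum_i a i * b i) ^+ 2 <= (\sum_i a i ^+ 2) * (\sum_i b i ^+ 2).
Proof.
set C := \sum_i a i * b i; set A := \sum_i a i ^+ 2; set B := \sum_i b i ^+ 2.
have B0 : 0 <= B by apply: sumr_ge0 => i _; exact: sqr_ge0.
have : 0 <= \sum_i (B * a i - C * b i) ^+ 2.
  by apply: sumr_ge0 => i _; exact: sqr_ge0.
have -> : \sum_i (B * a i - C * b i) ^+ 2 = B * (A * B - C ^+ 2).
  under eq_bigr => i _.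
    rewrite (_ : _ ^+ 2 = B ^+ 2 * a i ^+ 2 - 2 * B * C * (a i * b i)
      + C ^+ 2 * b i ^+ 2); last by ring.
    over.
  rewrite big_split/= sumrB -!mulr_sumr -/A -/B -/C; ring.
move: B0; rewrite le_eqVlt => /predU1P[B0 _|B0]; last first.
  by rewrite pmulr_rge0// subr_ge0.
have b0 i : b i = 0.
  apply/eqP; rewrite -sqrf_eq0; apply/eqP.
  by apply: (psumr_eq0P (F := fun i => b i ^+ 2) (P := xpredT)) => // j _;
    exact: sqr_ge0.
rewrite /C big1 ?expr0n/= => [|i _]; last by rewrite b0 mulr0.
by rewrite -B0 mulr0.
Qed.

Lemma edist_ge0 x y : 0 <= edist x y. Proof. exact: sqrtr_ge0. Qed.

Lemma edistxx x : edist x x = 0.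
Proof. by rewrite /edist big1 ?sqrtr0// => i _; rewrite subrr expr0n. Qed.

Lemma edistC x y : edist x y = edist y x.
Proof. by rewrite /edist; under eq_bigr do rewrite -sqrrN opprB. Qed.

Lemma sqr_edist x y : edist x y ^+ 2 = \sum_(i < m) (x 0 i - y 0 i) ^+ 2.
Proof. by rewrite sqr_sqrtr// sumr_ge0// => i _; exact: sqr_ge0. Qed.

Lemma edist_triangle y x z : edist x z <= edist x y + edist y z.
Proof.
rewrite -(ler_pXn2r (n := 2))// ?nnegrE ?edist_ge0 ?addr_ge0 ?edist_ge0//.
rewrite sqrrD !sqr_edist.
have -> : \sum_(i < m) (x 0 i - z 0 i) ^+ 2 = \sum_(i < m) (x 0 i - y 0 i) ^+ 2
    + (\sum_(i < m) (x 0 i - y 0 i) * (y 0 i - z 0 i)) *+ 2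
    + \sum_(i < m) (y 0 i - z 0 i) ^+ 2.
  rewrite -sumrMnl -!big_split/=; apply: eq_bigr => i _; ring.
rewrite lerD2r lerD2l lerMn2r/=.
rewrite (le_trans (ler_norm _))//.
rewrite -(ler_pXn2r (n := 2))// ?nnegrE ?mulr_ge0 ?edist_ge0//.
rewrite real_normK ?num_real// exprMn !sqr_edist.
exact: cauchy_schwarz_sum.
Qed.

Lemma edist_coord x y i : `|x 0 i - y 0 i| <= edist x y.
Proof.
rewrite -(ler_pXn2r (n := 2))// ?nnegrE ?edist_ge0// sqr_edist.
rewrite real_normK ?num_real// (bigD1 i)//= lerDl.
by apply: sumr_ge0 => j _; exact: sqr_ge0.
Qed.

Lemma edist_le_sum x y : edist x y <= \sum_(i < m) `|x 0 i - y 0 i|.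
Proof.
have [E0 ES] : 0 <= \sum_(i < m) `|x 0 i - y 0 i| /\
    \sum_(i < m) (x 0 i - y 0 i) ^+ 2 <= (\sum_(i < m) `|x 0 i - y 0 i|) ^+ 2.
  elim/big_ind2 : _ => [|s S t T [S0 sS] [T0 tT]|i _].
  - by rewrite expr0n.
  - by split; [exact: addr_ge0|nra].
  - by rewrite real_normK ?num_real.
by rewrite -(ler_pXn2r (n := 2))// ?nnegrE ?edist_ge0// sqr_edist.
Qed.

Lemma edist_eq0 x y : edist x y = 0 -> x = y.
Proof.
move=> xy0; apply/rowP => i; apply/eqP; rewrite -subr_eq0 -normr_le0.
by rewrite -xy0 edist_coord.
Qed.

(** The Euclidean distance lies between the sup distance and the sum of the coordinate distances, so
    both metrics give the same neighbourhoods. *)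
Lemma nbhs_edistP x (A : set 'rV[R]_m) :
  nbhs x A <-> exists2 e : R, 0 < e & forall y, edist x y < e -> A y.
Proof.
split=> [/nbhs_ballP[e e0 eA]|[e e0 eA]].
  exists e => // y xy; apply: eA; split=> // i j; rewrite (ord1 i).
  exact: le_lt_trans (edist_coord _ _ _) xy.
(* The divisor is [m.+1] rather than [m] so that the sum of the [m] coordinate bounds stays strictly
   below [e]. *)
have e'0 : 0 < e / m.+1%:R by rewrite divr_gt0.
apply/nbhs_ballP; exists (e / m.+1%:R) => // y xy; apply: eA.
rewrite (le_lt_trans (edist_le_sum _ _))//.
apply: (@le_lt_trans _ _ (\sum_(i < m) (e / m.+1%:R))).
  by apply: ler_sum => i _; rewrite ltW//; exact: (xy.2 0 i).
rewrite sumr_const card_ord -(mulr_natr (e / _)) -mulrA gtr_pMr// mulrC.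
by rewrite ltr_pdivrMr// mul1r ltr_nat.
Qed.

Lemma closed_edistP (A : set 'rV[R]_m) : closed A <->
  forall x, (forall e : R, 0 < e -> exists2 y, A y & edist x y < e) -> A x.
Proof.
split=> [cA x xA|cA x xA].
  apply: cA => B /nbhs_edistP[e e0 eB].
  by have [y Ay xy] := xA _ e0; exists y; split=> //; exact: eB.
apply: cA => e e0.
have /xA[y [Ay xy]] : nbhs x [set y | edist x y < e].
  by apply/nbhs_edistP; exists e.
by exists y.
Qed.

Lemma closed_eball x (r : R) : closed [set y | edist x y <= r].
Proof.
apply/closed_edistP => y yr /=; apply/ler_addgt0Pr => e e0.
have [z xz yz] := yr _ e0.
by rewrite (le_trans (edist_triangle z _ _))// lerD// edistC ltW.
Qed.

(** The ball is a closed subset of a product of segments, which is compact. *)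
Lemma compact_eball x (r : R) : compact [set y | edist x y <= r].
Proof.
have := @rV_compact R m (fun i => `[x 0 i - r, x 0 i + r]%classic)
  (fun i => @segment_compact R _ _).
move=> /subclosed_compact; apply; first exact: closed_eball.
move=> y /= xy i; rewrite in_itv/=.
have := le_trans (edist_coord x y i) xy.
by rewrite (ord1 ord0) ler_distlC => /andP[-> ->].
Qed.

End euclidean_distance.

(** * The extended-valued Hausdorff distance *)

Section hausdorff.
Context {R : realType} {m : nat}.
Implicit Types A B C : set 'rV[R]_m.
Local Open Scope ereal_scope.

Lemma hausdorff_distC A B : hausdorff_dist A B = hausdorff_dist B A.
Proof.
have swap (C D : set 'rV[R]_m) :
    [set ereal_inf [set (edist a b)%:E | b in D] | a in C] =
    [set ereal_inf [set (edist b a)%:E | b in D] | a in C].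
  apply: eq_imagel => a _; congr ereal_inf.
  by apply: eq_imagel => b _; rewrite edistC.
by rewrite /hausdorff_dist maxC (swap A B) (swap B A).
Qed.

Lemma hausdorff_dist_le A B (r : R) :
  (forall a, A a -> exists2 b, B b & (edist a b <= r)%R) ->
  (forall b, B b -> exists2 a, A a & (edist b a <= r)%R) ->
  hausdorff_dist A B <= r%:E.
Proof.
move=> AB BA; rewrite ge_max; apply/andP; split.
- apply: ge_ereal_sup => _ [a /AB[b Bb ab] <-].
  apply: ge_ereal_inf; exists (edist a b)%:E; last by rewrite lee_fin.
  by exists b.
- apply: ge_ereal_sup => _ [b /BA[a Aa ab] <-].
  apply: ge_ereal_inf; exists (edist a b)%:E; last by rewrite edistC lee_fin.
  by exists a.
Qed.

Lemma hausdorff_dist_lt A B (r : R) : hausdorff_dist A B < r%:E ->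
  forall a, A a -> exists2 b, B b & (edist a b < r)%R.
Proof.
rewrite gt_max => /andP[+ _] a Aa => ABr.
have : ereal_inf [set (edist a b)%:E | b in B] < r%:E.
  by apply: le_lt_trans ABr; apply: ereal_sup_ubound; exists a.
by move=> /ereal_inf_lt[_ [b Bb <-]]; rewrite lte_fin; exists b.
Qed.

Lemma hausdorff_dist_ge A B (c : R) a : A a ->
  (forall b, B b -> (c <= edist a b)%R) -> c%:E <= hausdorff_dist A B.
Proof.
move=> Aa aB; rewrite le_max; apply/orP; left.
apply: le_ereal_sup_tmp; exists (ereal_inf [set (edist a b)%:E | b in B]).
  by exists a.
by apply: le_ereal_inf_tmp => _ [b Bb <-]; rewrite lee_fin aB.
Qed.

(** Without such a witness every point of either set would be within [c + e] of the other set for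
    all [e > 0]. The margin of [d] over [c] is what later survives a small change of level. *)
Lemma hausdorff_dist_gt A B (c : R) : c%:E < hausdorff_dist A B ->
  (exists2 a, A a & exists2 d : R, (c < d)%R & forall b, B b -> (d <= edist a b)%R) \/
  (exists2 b, B b & exists2 d : R, (c < d)%R & forall a, A a -> (d <= edist b a)%R).
Proof.
move=> cAB; apply: contrapT => /not_orP[/forall2NP AB /forall2NP BA].
have near (C D : set 'rV[R]_m) : (forall a, ~ C a \/ ~ (exists2 d : R, (c < d)%R &
    forall b, D b -> (d <= edist a b)%R)) ->
    forall e : R, (0 < e)%R -> forall a, C a -> exists2 b, D b & (edist a b <= c + e)%R.
  move=> CD e e0 a Ca; case: (CD a) => // /forall2NP /(_ (c + e)%R)[|].
    by rewrite ltrDl.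
  move=> /existsNP[b /not_implyP[Db /negP]]; rewrite -ltNge => /ltW ab.
  by exists b.
move: cAB; rewrite ltNge => /negP; apply; apply/lee_addgt0Pr => e e0.
by rewrite -EFinD; apply: hausdorff_dist_le; exact: near.
Qed.

Lemma hausdorff_dist_ge0 A B : A !=set0 -> 0 <= hausdorff_dist A B.
Proof.
by move=> [a Aa]; apply: (@hausdorff_dist_ge _ _ _ a) => // b _; exact: edist_ge0.
Qed.

Lemma hausdorff_distxx A : A !=set0 -> hausdorff_dist A A = 0.
Proof.
move=> A0; apply/eqP; rewrite eq_le hausdorff_dist_ge0// andbT.
by apply: hausdorff_dist_le => a Aa; exists a; rewrite ?edistxx.
Qed.

(** Nonemptiness makes both terms on the right nonnegative, so an infinite one settles the claim.
    When both are finite, nearby points are chained with slack [e / 2] each. *)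
Lemma hausdorff_dist_triangle B A C : A !=set0 -> B !=set0 -> C !=set0 ->
  hausdorff_dist A C <= hausdorff_dist A B + hausdorff_dist B C.
Proof.
move=> A0 B0 C0; have := hausdorff_dist_ge0 B A0; have := hausdorff_dist_ge0 C B0.
case BCE : (hausdorff_dist B C) => [b| |]//; last first.
  by move=> _; case: (hausdorff_dist A B) => // [r|] _; rewrite leey.
case ABE : (hausdorff_dist A B) => [a| |]//; last first.
  by move=> _ _; rewrite addye// leey.
move=> _ _; apply/lee_addgt0Pr => e e0.
have e20 : (0 < e / 2)%R by rewrite divr_gt0.
have AB : hausdorff_dist A B < (a + e / 2)%:E by rewrite ABE lte_fin ltrDl.
have BC : hausdorff_dist B C < (b + e / 2)%:E by rewrite BCE lte_fin ltrDl.
have dle (x y z : 'rV[R]_m) (r s : R) : (edist x y < r -> edist y z < s ->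
    r + s = a + b + e -> edist x z <= a + b + e)%R.
  by move=> xy yz <-; rewrite (le_trans (edist_triangle y _ _))// lerD// ltW.
rewrite -!EFinD; apply: hausdorff_dist_le => x.
- move=> /(hausdorff_dist_lt AB)[y /(hausdorff_dist_lt BC)[z Cz yz] xy].
  exists z => //; apply: dle xy yz _; lra.
- rewrite hausdorff_distC in BC; rewrite hausdorff_distC in AB.
  move=> /(hausdorff_dist_lt BC)[y /(hausdorff_dist_lt AB)[z Cz yz] xy].
  exists z => //; apply: dle xy yz _; lra.
Qed.

End hausdorff.

(** * Measurability of sets that are open to the left *)

Section left_open_measurability.
Context {R : realType}.
Implicit Types U : set R.

(* [U] is the union, over rational [q], of the intervals of those [a >= q] with
   [[q, a]] contained in [U]. *)
Lemma left_open_measurable U :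
  (forall a, U a -> exists2 b, b < a & forall c, b <= c <= a -> U c) ->
  measurable U.
Proof.
move=> Uleft.
pose V (q : rat) := [set a : R | ratr q <= a /\ forall c, ratr q <= c <= a -> U c].
have -> : U = \bigcup_q V q.
  apply/seteqP; split => [a /Uleft[b ba bU]|a [q _ [qa]]]; last first.
    by apply; rewrite qa lexx.
  have [q /andP[bq qa]] := rat_in_itvoo ba.
  exists q => //; split; first exact: ltW.
  by move=> c /andP[qc ca]; apply: bU; rewrite ca (le_trans (ltW bq)).
apply: bigcupT_measurable_rat => q; apply: is_interval_measurable.
move=> a b [qa aU] [qb bU] c /andP[ac cb]; split; first exact: le_trans ac.
by move=> d /andP[qd dc]; apply: bU; rewrite qd (le_trans dc).
Qed.

End left_open_measurability.

(** * Upper semicontinuous functions on compact sets *)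

Section upper_semicontinuity.
Context {R : realType} {T : topologicalType}.

(** Near each point of [K] the function stays below a constant smaller than [a]; compactness lets a
    single constant serve all of [K]. *)
Lemma usc_compact_lt (v : T -> R) (K : set T) (a : R) :
  upper_semicontinuous v -> compact K -> (forall x, K x -> v x < a) ->
  exists2 b, b < a & forall x, K x -> v x < b.
Proof.
move=> vusc /compact_near_coveringP cK va.
have : \forall b \near a^'-, K `<=` [set x | v x < b].
  apply: cK => x /va vxa.
  have [c /andP[vxc ca]] : exists c, v x < c < a.
    by exists ((v x + a) / 2); rewrite midf_lt// midf_lt.
  near=> y b => /=; apply: (@lt_trans _ _ c).
    by near: y; exact: vusc.
  by near: b; exact: nbhs_left_gt.
move=> Kb.
have [b [ba Kvb]] : exists b, b < a /\ K `<=` [set x | v x < b].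
  have : \forall b \near a^'-, b < a /\ K `<=` [set x | v x < b].
    by near=> b; split; near: b; [exact: nbhs_left_lt|].
  by move=> /filter_ex.
by exists b.
Unshelve. all: by end_near. Qed.

End upper_semicontinuity.

(** * Norms of nonnegative extended-real functions *)

Section nonneg_Lnorm.
Context {d} {T : measurableType d} {R : realType}.
Variable mu : {measure set T -> \bar R}.
Implicit Types (f g h : T -> \bar R) (p : R).
Local Open Scope ereal_scope.

Lemma ge0_le_poweR p (x y : \bar R) : (0 <= p)%R -> 0 <= x -> x <= y ->
  x `^ p <= y `^ p.
Proof.
by move=> p0 x0 xy; apply: gt0_ler_poweR; rewrite ?in_itv/= ?leey ?andbT// (le_trans x0).
Qed.

Lemma ge0_le_Lnorm p f g : (0 < p)%R ->
  measurable_fun [set: T] f -> measurable_fun [set: T] g ->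
  (forall x, 0 <= f x) -> (forall x, f x <= g x) ->
  'N[mu]_p%:E[f] <= 'N[mu]_p%:E[g].
Proof.
move=> p0 mf mg f0 fg.
have g0 x : 0 <= g x by exact: le_trans (fg x).
rewrite unlock/= ge0_le_poweR ?invr_ge0 ?(ltW p0)//.
  by apply: integral_ge0 => x _; exact: poweR_ge0.
apply: ge0_le_integral => //.
- by move=> x _; exact: poweR_ge0.
- by apply: (measurableT_comp (measurable_poweR _)); exact: measurableT_comp.
- by apply: (measurableT_comp (measurable_poweR _)); exact: measurableT_comp.
move=> x _; rewrite gee0_abs// gee0_abs// ge0_le_poweR// ltW//.
Qed.

Lemma ae_eq_Lnorm p f g : measurable_fun [set: T] f -> measurable_fun [set: T] g ->
  (\forall x \ae mu, f x = g x) -> 'N[mu]_p%:E[f] = 'N[mu]_p%:E[g].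
Proof.
move=> mf mg fg; rewrite unlock/=; congr (_ `^ _).
apply: ae_eq_integral => //.
- by apply: (measurableT_comp (measurable_poweR _)); exact: measurableT_comp.
- by apply: (measurableT_comp (measurable_poweR _)); exact: measurableT_comp.
- by apply: filterS fg => x /= ->.
Qed.

Lemma Lnorm_fin_ae p f : (0 < p)%R -> measurable_fun [set: T] f ->
  (forall x, 0 <= f x) ->
  'N[mu]_p%:E[f] < +oo -> \forall x \ae mu, f x \is a fin_num.
Proof.
move=> p0 mf f0 Nf.
have mfp : measurable_fun [set: T] (fun x => `|f x| `^ p).
  by apply: (measurableT_comp (measurable_poweR _)); exact: measurableT_comp.
have /integrable_ae : mu.-integrable setT (fun x => `|f x| `^ p).
  apply/integrableP; split=> //.
  under eq_integral do rewrite gee0_abs ?poweR_ge0//.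
  by rewrite -poweR_Lnorm ?gt_eqF// poweR_lty.
move=> /(_ measurableT); apply: filterS => x /(_ I).
rewrite gee0_abs// => fx; rewrite ge0_fin_numE//.
apply: (@lty_poweRy _ _ p); first by rewrite gt_eqF.
by rewrite -ge0_fin_numE// poweR_ge0.
Qed.

(** If one norm is infinite there is nothing to prove. Otherwise both functions are finite almost
    everywhere, and the real-valued Minkowski inequality applies to their finite parts. *)
Lemma ge0_minkowski p f g : (1 <= p)%R ->
  measurable_fun [set: T] f -> measurable_fun [set: T] g ->
  (forall x, 0 <= f x) -> (forall x, 0 <= g x) ->
  'N[mu]_p%:E[f \+ g] <= 'N[mu]_p%:E[f] + 'N[mu]_p%:E[g].
Proof.
move=> p1 mf mg f0 g0; have p0 : (0 < p)%R by exact: lt_le_trans p1.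
have [Nf|] := ltP 'N[mu]_p%:E[f] +oo; last first.
  rewrite leye_eq => /eqP ->; rewrite addye ?leey// gt_eqF//.
  exact: lt_le_trans (Lnorm_ge0 _ _ _).
have [Ng|] := ltP 'N[mu]_p%:E[g] +oo; last first.
  rewrite leye_eq => /eqP ->; rewrite addey ?leey// gt_eqF//.
  exact: lt_le_trans (Lnorm_ge0 _ _ _).
have mf' : measurable_fun [set: T] (fine \o f) by exact: measurableT_comp.
have mg' : measurable_fun [set: T] (fine \o g) by exact: measurableT_comp.
have ff := Lnorm_fin_ae p0 mf f0 Nf; have gf := Lnorm_fin_ae p0 mg g0 Ng.
rewrite (@ae_eq_Lnorm p f (EFin \o (fine \o f)))//; last 2 first.
- exact/measurable_EFinP.
- by apply: filterS ff => x fx /=; rewrite fineK.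
rewrite (@ae_eq_Lnorm p g (EFin \o (fine \o g)))//; last 2 first.
- exact/measurable_EFinP.
- by apply: filterS gf => x gx /=; rewrite fineK.
rewrite (@ae_eq_Lnorm p (f \+ g) (EFin \o ((fine \o f) \+ (fine \o g))%R)).
- exact: minkowski_EFin.
- exact: emeasurable_funD.
- by apply/measurable_EFinP; exact: measurable_funD.
- by apply: filterS2 ff gf => x fx gx /=; rewrite EFinD !fineK.
Qed.

Lemma ge0_Lnorm_triangle p f g h : (1 <= p)%R ->
  measurable_fun [set: T] f -> measurable_fun [set: T] g -> measurable_fun [set: T] h ->
  (forall x, 0 <= f x) -> (forall x, 0 <= g x) -> (forall x, 0 <= h x) ->
  (forall x, h x <= f x + g x) ->
  'N[mu]_p%:E[h] <= 'N[mu]_p%:E[f] + 'N[mu]_p%:E[g].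
Proof.
move=> p1 mf mg mh f0 g0 h0 hfg; have p0 : (0 < p)%R by exact: lt_le_trans p1.
apply: le_trans (ge0_minkowski p1 mf mg f0 g0).
by apply: ge0_le_Lnorm => //; exact: emeasurable_funD.
Qed.

(** Markov's inequality at the threshold [2^-k] gives exceptional sets of measure at most [2^-k];
    Borel-Cantelli concludes. *)
Lemma Lnorm_summable_ae p (f : (T -> \bar R)^nat) : (1 <= p)%R ->
  (forall k, measurable_fun [set: T] (f k)) -> (forall k x, 0 <= f k x) ->
  (forall k, 'N[mu]_p%:E[f k] <= ((4^-1) ^+ k)%:E) ->
  \forall x \ae mu, \forall k \near \oo, f k x < ((2^-1) ^+ k)%:E.
Proof.
move=> p1 mf f0 Nf; have p0 : (0 < p)%R by exact: lt_le_trans p1.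
pose e k : R := ((2^-1) ^+ k)%R.
have e0 k : (0 < e k)%R by rewrite exprn_gt0// invr_gt0.
have e1 k : (e k <= 1)%R by rewrite exprn_ile1// invf_le1// ler1n.
pose F k := [set x | (e k)%:E <= f k x].
have mF k : measurable (F k).
  by rewrite -[F k]setTI; exact: emeasurable_fun_c_infty.
have muF k : mu (F k) <= (e k)%:E.
  have : ((e k) `^ p)%:E * mu (F k) <= ((e k) `^ p)%:E * (e k)%:E.
    apply: (@le_trans _ _ ('N[mu]_p%:E[f k] `^ p)).
      rewrite poweR_Lnorm ?gt_eqF//.
      have := @le_integral_comp_abse _ _ _ mu _ measurableT (f k) (e k) (poweR ^~ p).
      rewrite setTI poweR_EFin.
      rewrite [X in mu X](_ : _ = F k); last first.
        by apply/seteqP; split => x; rewrite /F/= gee0_abs.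
      apply => //.
      - exact: measurable_poweR.
      - by move=> r _; exact: poweR_ge0.
      - move=> x y; rewrite !inE/= !in_itv/= !andbT => x0 y0 xy.
        by rewrite ge0_le_poweR// ltW.
    apply: (@le_trans _ _ (((4^-1) ^+ k)%:E `^ p)).
      by rewrite ge0_le_poweR ?(ltW p0)// Lnorm_ge0.
    (* As [4^-k] is the square of the threshold, its [p]-th power is the product of two [p]-th
       powers of [e k]. One matches the factor on the left, and the other is at most [e k] because
       [e k <= 1 <= p]. *)
    have -> : ((4^-1) ^+ k = e k * e k :> R)%R.
      by rewrite /e -exprMn -invfM -natrM.
    have -> : (e k * e k)%:E `^ p = (e k `^ p * e k `^ p)%:E.
      by rewrite poweR_EFin powRM// ltW.
    by rewrite -EFinM lee_fin ler_wpM2l ?powR_ge0// ge1r_powR// e0/=.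
  by rewrite lee_pmul2l// lte_fin powR_gt0.
have sumF : \sum_(k <oo) mu (F k) < +oo.
  apply: (@le_lt_trans _ _ (\sum_(k <oo) (2 / (2 ^ (k + 1))%:R : R)%:E)).
    apply: lee_nneseries => k //= _; rewrite (le_trans (muF k))// lee_fin.
    by rewrite /e addn1 expnS natrM invfM mulrA divff// mul1r natrX exprVn.
  by rewrite (cvg_lim _ (@cvg_geometric_eseries_half R 2 0))// ltry.
have := lim_sup_set_cvg0 mF sumF => F0.
exists (lim_sup_set F); split => //.
  apply: bigcap_measurable => // k _; exact: bigcup_measurable.
move=> x /= xF n _; apply: contrapT => nF; apply: xF.
exists n => // k /= nk; rewrite ltNge; apply/negP => fk.
by apply: nF; exists k.
Qed.

End nonneg_Lnorm.

(** * Fatou's lemma for norms *)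

Section Lnorm_fatou.
Context {d} {T : measurableType d} {R : realType}.
Variable mu : {measure set T -> \bar R}.
Local Open Scope ereal_scope.

Lemma limn_einf_sup_einfs (u : (\bar R)^nat) : limn_einf u = ereal_sup (range (einfs u)).
Proof. by rewrite limn_einf_lim (cvg_lim _ (@cvg_einfs_sup _ u)). Qed.

Lemma near_le_limn_einf (u : (\bar R)^nat) c :
  (\forall k \near \oo, c <= u k) -> c <= limn_einf u.
Proof.
move=> [N _ cu]; rewrite limn_einf_sup_einfs; apply: le_ereal_sup_tmp.
by exists (einfs u N) => //; apply: le_ereal_inf_tmp => _ [k /= Nk <-]; exact: cu.
Qed.

Lemma near_limn_einf_le (u : (\bar R)^nat) c :
  (\forall k \near \oo, u k <= c) -> limn_einf u <= c.
Proof.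
move=> [N _ uc]; rewrite limn_einf_sup_einfs; apply: ge_ereal_sup => _ [n _ <-].
apply: ge_ereal_inf; exists (u (maxn n N)); last by apply: uc; exact: leq_maxr.
by exists (maxn n N) => //=; exact: leq_maxl.
Qed.

(** Fatou's lemma applied to [p]-th powers. Domination of [f] by the lower limit of the [g k] is
    phrased through reals [c] below [f x], which also covers points where [f] is infinite. *)
Lemma ge0_Lnorm_fatou (p M : R) (f : T -> \bar R) (g : (T -> \bar R)^nat) :
  (0 < p)%R -> (0 <= M)%R -> measurable_fun [set: T] f ->
  (forall k, measurable_fun [set: T] (g k)) ->
  (forall x, 0 <= f x) -> (forall k x, 0 <= g k x) ->
  (\forall x \ae mu, forall c : R, c%:E < f x -> \forall k \near \oo, c%:E <= g k x) ->
  (\forall k \near \oo, 'N[mu]_p%:E[g k] <= M%:E) ->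
  'N[mu]_p%:E[f] <= M%:E.
Proof.
move=> p0 M0 mf mg f0 g0 fg gM.
pose gp k x := `|g k x| `^ p.
have mgp k : measurable_fun [set: T] (gp k).
  by apply: (measurableT_comp (measurable_poweR _)); exact: measurableT_comp.
have gp0 k x : [set: T] x -> 0 <= gp k x by move=> _; exact: poweR_ge0.
have intM : \int[mu]_x limn_einf (gp ^~ x) <= M%:E `^ p.
  apply: le_trans (fatou mu measurableT mgp gp0) _.
  apply: near_limn_einf_le; apply: filterS gM => k gkM.
  by rewrite -poweR_Lnorm ?gt_eqF// ge0_le_poweR ?(ltW p0) ?Lnorm_ge0.
have rootK (x : \bar R) : 0 <= x -> (x `^ p) `^ p^-1 = x.
  by move=> x0; rewrite -poweRrM mulfV ?gt_eqF// poweRe1.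
have unroot (x : \bar R) : 0 <= x -> (x `^ p^-1) `^ p = x.
  by move=> x0; rewrite -poweRrM mulVf ?gt_eqF// poweRe1.
rewrite -[leLHS]rootK ?Lnorm_ge0// -[leRHS]rootK//.
rewrite ge0_le_poweR ?invr_ge0 ?(ltW p0) ?poweR_ge0// poweR_Lnorm ?gt_eqF//.
apply: le_trans intM; apply: ae_ge0_le_integral => //.
- by move=> x _; exact: poweR_ge0.
- by apply: (measurableT_comp (measurable_poweR _)); exact: measurableT_comp.
- by move=> x _; apply: near_le_limn_einf; apply: nearW => k; exact: gp0.
- apply: (measurableT_comp (f := -%E)) => //.
  apply: (@measurable_fun_limn_esup _ _ _ _ (fun k x => - gp k x)) => k.
  exact: measurableT_comp.
apply: filterS fg => x fgx _; rewrite gee0_abs//.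
set y := limn_einf _.
have y0 : 0 <= y by apply: near_le_limn_einf; apply: nearW => k; exact: gp0.
rewrite -(unroot y)// ge0_le_poweR ?(ltW p0)//.
have cy (c : R) : (0 <= c)%R -> c%:E < f x -> c%:E <= y `^ p^-1.
  move=> c0 cf; rewrite -(rootK c%:E)// ge0_le_poweR ?invr_ge0 ?(ltW p0) ?poweR_ge0//.
  apply: near_le_limn_einf; apply: filterS (fgx _ cf) => k ck.
  by rewrite /gp gee0_abs// ge0_le_poweR// ltW.
have yp0 : 0 <= y `^ p^-1 := poweR_ge0 _ _.
rewrite leNgt; apply/negP; move: yp0 cy.
case: (y `^ p^-1) => [r| |] => [|_ _|]; [|by rewrite ltNge leey|by []].
rewrite lee_fin => r0 cy rf.
(* A real strictly between [r] and [f x] exists whether or not [f x] is finite; [cy] then gives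
   [c <= r], a contradiction. *)
have [c rc cf] : exists2 c : R, (r < c)%R & c%:E < f x.
  move: rf; case: (f x) => [s| |]//.
    rewrite lte_fin => rs; exists ((r + s) / 2)%R; rewrite ?lte_fin midf_lt//.
  by move=> _; exists (r + 1)%R; rewrite ?ltrDl ?ltry.
by have := cy c (le_trans r0 (ltW rc)) cf; rewrite lee_fin leNgt rc.
Qed.

End Lnorm_fatou.

(** * The distance between cuts as a measurable function of the level *)

Section cut_distance.
Context {R : realType} {m : nat}.
Local Notation V := 'rV[R]_m.
Implicit Types (u v w : V -> R).
Local Open Scope ereal_scope.

Lemma fuzzy_cut_gt0 u (a : R) : (0 < a)%R -> fuzzy_cut u a = [set x | (a <= u x)%R].
Proof. by move=> a0; rewrite /fuzzy_cut gt_eqF. Qed.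

Lemma fuzzy_cut_nonempty u (a : R) : (0 <= a <= 1)%R -> normal_fuzzy u ->
  fuzzy_cut u a !=set0.
Proof.
move=> /andP[a0 a1] [x ux]; exists x; rewrite /fuzzy_cut; case: ifPn => _ /=.
  by apply: subset_closure; rewrite /= ux.
by rewrite ux.
Qed.

Lemma fuzzy_cut_closed u (a : R) : (0 < a)%R -> upper_semicontinuous u ->
  closed (fuzzy_cut u a).
Proof.
move=> a0 usc; rewrite fuzzy_cut_gt0// => x xa /=; rewrite leNgt; apply/negP => ux.
by have [y [/= ay]] := xa _ (usc _ _ ux); rewrite ltNge ay.
Qed.

(** A point [x] of one cut that is further than [c] from the other cut stays in all lower cuts. The
    other cut avoids a compact ball around [x], where its function is therefore below some [b < a];
    so its cuts at levels from [b] to [a] avoid the ball too. *)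
Lemma hausdorff_cut_left u v (a c : R) : (0 < a)%R ->
  upper_semicontinuous u -> upper_semicontinuous v ->
  c%:E < hausdorff_dist (fuzzy_cut u a) (fuzzy_cut v a) ->
  exists2 b, (0 < b < a)%R & forall a', (b <= a' <= a)%R ->
    c%:E < hausdorff_dist (fuzzy_cut u a') (fuzzy_cut v a').
Proof.
move=> a0 uusc vusc.
have half (w1 w2 : V -> R) : upper_semicontinuous w2 ->
    (exists2 x, fuzzy_cut w1 a x & exists2 d : R, (c < d)%R &
      forall y, fuzzy_cut w2 a y -> (d <= edist x y)%R) ->
    exists2 b, (0 < b < a)%R & forall a', (b <= a' <= a)%R ->
    c%:E < hausdorff_dist (fuzzy_cut w1 a') (fuzzy_cut w2 a').
  rewrite !fuzzy_cut_gt0// => w2usc [x /= ax [d cd dx]].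
  have [e /andP[ce ed]] : exists e, (c < e < d)%R.
    by exists ((c + d) / 2)%R; rewrite midf_lt// midf_lt.
  have [b ba bw] : exists2 b, (b < a)%R &
      forall y, (edist x y <= e)%R -> (w2 y < b)%R.
    apply: (usc_compact_lt w2usc (@compact_eball _ _ x e)) => y /= xy.
    by rewrite ltNge; apply/negP => /dx; rewrite leNgt (le_lt_trans xy ed).
  (* The maximum with [a / 2] keeps the levels positive, where cuts are plain superlevel sets. *)
  exists (Num.max b (a / 2))%R.
    by rewrite lt_max gt_max ba divr_gt0 ?orbT//= ltr_pdivrMr// ltr_pMr// ltr1n.
  move=> a' /andP[]; rewrite ge_max => /andP[ba' a2a'] a'a.
  have a'0 : (0 < a')%R by apply: lt_le_trans a2a'; rewrite divr_gt0.
  apply: (@lt_le_trans _ _ e%:E); first by rewrite lte_fin.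
  apply: (@hausdorff_dist_ge _ _ _ _ _ x).
    by rewrite fuzzy_cut_gt0//= (le_trans a'a).
  move=> y; rewrite fuzzy_cut_gt0//= leNgt => ay; rewrite leNgt.
  by apply/negP => /ltW /bw; apply/negP; rewrite -leNgt (le_trans ba')// leNgt.
move=> /hausdorff_dist_gt[/half|/half]; first exact.
move=> /(_ uusc)[b b0 bc]; exists b => // a' /bc.
by rewrite hausdorff_distC.
Qed.

(** Level [0] is discarded: the cut there is a closure, and it does not affect the
    integral. *)
Definition cut_dist u v : R -> \bar R :=
  (fun a => hausdorff_dist (fuzzy_cut u a) (fuzzy_cut v a)) \_ `]0%R, 1%R].

Lemma cut_distE u v (a : R) : (0 < a <= 1)%R ->
  cut_dist u v a = hausdorff_dist (fuzzy_cut u a) (fuzzy_cut v a).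
Proof. by move=> a01; rewrite /cut_dist patchE mem_set//= in_itv. Qed.

Lemma cut_dist_out u v (a : R) : ~~ (0 < a <= 1)%R -> cut_dist u v a = 0.
Proof. by move=> /negP a01; rewrite /cut_dist patchE memNset//= in_itv. Qed.

Lemma cut_dist_ge0 u v a : normal_fuzzy u -> 0 <= cut_dist u v a.
Proof.
move=> nu; have [a01|a01] := boolP (0 < a <= 1)%R; last by rewrite cut_dist_out.
rewrite cut_distE//; apply: hausdorff_dist_ge0; apply: fuzzy_cut_nonempty => //.
by case/andP: a01 => /ltW -> ->.
Qed.

Lemma cut_distC u v : cut_dist u v = cut_dist v u.
Proof. by apply/funext => a; rewrite /cut_dist !patchE hausdorff_distC. Qed.

Lemma cut_distxx u : normal_fuzzy u -> cut_dist u u = cst 0.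
Proof.
move=> nu; apply/funext => a.
have [a01|a01] := boolP (0 < a <= 1)%R; last by rewrite cut_dist_out.
rewrite cut_distE// hausdorff_distxx//; apply: fuzzy_cut_nonempty => //.
by case/andP: a01 => /ltW -> ->.
Qed.

Lemma cut_dist_triangle v u w a : normal_fuzzy u -> normal_fuzzy v -> normal_fuzzy w ->
  cut_dist u w a <= cut_dist u v a + cut_dist v w a.
Proof.
move=> nu nv nw.
have [a01|a01] := boolP (0 < a <= 1)%R; last by rewrite !cut_dist_out// adde0.
rewrite !cut_distE//; case/andP: a01 => /ltW a0 a1.
by apply: hausdorff_dist_triangle; apply: fuzzy_cut_nonempty => //; apply/andP.
Qed.

Lemma measurable_hausdorff_cut u v :
  upper_semicontinuous u -> upper_semicontinuous v ->
  measurable_fun (`]0%R, 1%R] : set R)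
    (fun a : R => hausdorff_dist (fuzzy_cut u a) (fuzzy_cut v a)).
Proof.
move=> uusc vusc.
apply: (measurability (@ErealGenOInfty.G R)).
  exact: ErealGenOInfty.measurableE.
move=> _ [_ [c ->] <-]; apply: left_open_measurable => a [].
rewrite /= in_itv/= => /andP[a0 a1]; rewrite in_itv/= andbT => ca.
have [b /andP[b0 ba] bc] := hausdorff_cut_left a0 uusc vusc ca.
exists b => // a' /andP[ba' a'a]; split => /=; rewrite in_itv/=.
  by rewrite (lt_le_trans b0 ba') (le_trans a'a a1).
by rewrite andbT; apply: bc; rewrite ba' a'a.
Qed.

Lemma measurable_cut_dist u v :
  upper_semicontinuous u -> upper_semicontinuous v ->
  measurable_fun [set: R] (cut_dist u v).
Proof.
move=> uusc vusc; apply/(measurable_restrictT _ _).1 => //.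
exact: measurable_hausdorff_cut.
Qed.

(** The endpoint [0] is a null set, and extending by zero outside []0, 1]] adds nothing since the
    [p]-th power of [0] is [0]. *)
Lemma dpE (p : R) u v : (0 < p)%R -> upper_semicontinuous u -> upper_semicontinuous v ->
  normal_fuzzy u -> dp p u v = 'N[lebesgue_measure]_p%:E[cut_dist u v].
Proof.
move=> p0 uusc vusc nu; rewrite /dp unlock/=; congr (_ `^ _).
rewrite -integral_itv_obnd_cbnd; last first.
  by apply: (measurableT_comp (measurable_poweR _)); exact: measurable_hausdorff_cut.
rewrite [LHS]integral_mkcond; apply: eq_integral => a _.
rewrite gee0_abs ?cut_dist_ge0//.
rewrite /cut_dist !patchE; case: ifPn => // _.
by rewrite poweR0r// gt_eqF.
Qed.

End cut_distance.

(** * The metric axioms, and the inclusion of [Sm] in [Smp p] *)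

Section Lp_metric.
Context {R : realType} {m : nat}.
Local Notation V := 'rV[R]_m.
Implicit Types (u v w : V -> R) (p : R).
Local Open Scope ereal_scope.
Local Notation mu := (@lebesgue_measure R).

(** A nonempty open interval has positive measure, so it cannot lie inside the exceptional null
    set. *)
Lemma ae_itv_exists (P : R -> Prop) (a b : R) : (a < b)%R ->
  (\forall x \ae mu, P x) -> exists2 x, (a < x < b)%R & P x.
Proof.
move=> ab [N [mN N0 PN]]; apply: contrapT => /forall2NP noP.
have abN : `]a, b[ `<=` N.
  move=> x /=; rewrite in_itv/= => xab; apply: PN => /= Px.
  by case: (noP x).
have : mu (`]a, b[ : set R) <= mu N by apply: le_measure; rewrite ?inE.
rewrite N0 lebesgue_measure_itv/= lte_fin ab -EFinB lee_fin subr_le0.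
by rewrite leNgt ab.
Qed.

(** Every cut of it at a level in [[0, 1]] is the origin alone, which turns the integrability
    condition of [Smp p] into finiteness of a distance. *)
Definition crisp0 : V -> R := fun x => (x == 0%R)%:R%R.

Lemma crisp0_normal : normal_fuzzy crisp0.
Proof. by exists 0%R; rewrite /crisp0 eqxx. Qed.

Lemma crisp0_usc : upper_semicontinuous crisp0.
Proof.
move=> x a; rewrite /crisp0; have [->|x0] := eqVneq x 0%R => xa.
  apply/nbhs_edistP; exists 1%R => // y _.
  by apply: le_lt_trans xa; rewrite ler_nat leq_b1.
apply/nbhs_edistP; exists (edist x 0) => [|y xy].
  rewrite lt_neqAle edist_ge0 andbT eq_sym; apply: contra x0 => /eqP.
  by move/edist_eq0 => ->.
by case: (eqVneq y 0%R) xy => [->|//]; rewrite ltxx.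
Qed.

Lemma fuzzy_cut_crisp0 (a : R) : (0 <= a <= 1)%R -> fuzzy_cut crisp0 a = [set 0%R].
Proof.
move=> /andP[a0 a1].
have pos (b : R) : (0 < b <= 1)%R -> [set x | (b <= crisp0 x)%R] = [set 0%R].
  move=> /andP[b0 b1]; apply/seteqP; split => x /=; rewrite /crisp0.
    by case: eqP => //= _; rewrite leNgt b0.
  by move=> ->; rewrite eqxx.
rewrite /fuzzy_cut; case: ifPn => a0'; last by rewrite pos// lt_neqAle eq_sym a0' a0.
rewrite (_ : [set x | _] = [set 0%R]).
  apply/esym/closure_id/closed_edistP => x x0 /=; apply: edist_eq0.
  apply/eqP; rewrite eq_le edist_ge0 andbT; apply/ler_addgt0Pr => e e0.
  by have [y -> /ltW] := x0 _ e0; rewrite add0r.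
rewrite -(pos 1%R) ?ltr01 ?lexx//; apply/seteqP; split => x /=; rewrite /crisp0.
  by case: eqP; rewrite ?ltxx.
by move=> /(lt_le_trans ltr01).
Qed.

Lemma fuzzy_star_LpE p u : fuzzy_star_Lp p u <-> dp p u crisp0 < +oo.
Proof.
rewrite /fuzzy_star_Lp /dp.
suff -> : \int[mu]_(a in `[0%R, 1%R])
      hausdorff_dist (fuzzy_cut u a) (fuzzy_cut crisp0 a) `^ p
    = \int[mu]_(a in `[0%R, 1%R]) hausdorff_dist (fuzzy_cut u a) [set 0%R] `^ p by [].
apply: eq_integral => a; rewrite inE/= in_itv/= => a01.
by rewrite fuzzy_cut_crisp0.
Qed.

Section pth_power_metric.
Variable p : R.
Hypothesis p1 : (1 <= p)%R.
Let p0 : (0 < p)%R. Proof. exact: lt_le_trans p1. Qed.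

Lemma dp_ge0 u v : 0 <= dp p u v.
Proof. exact: poweR_ge0. Qed.

Lemma dpC u v : dp p u v = dp p v u.
Proof.
rewrite /dp; congr (_ `^ _); apply: eq_integral => a _.
by rewrite hausdorff_distC.
Qed.

Lemma dpxx u : normal_fuzzy u -> upper_semicontinuous u -> dp p u u = 0.
Proof. by move=> nu su; rewrite dpE// cut_distxx// Lnorm0// eqe gt_eqF. Qed.

Lemma dp_triangle v u w : normal_fuzzy u -> normal_fuzzy v -> normal_fuzzy w ->
  upper_semicontinuous u -> upper_semicontinuous v -> upper_semicontinuous w ->
  dp p u w <= dp p u v + dp p v w.
Proof.
move=> nu nv nw su sv sw; rewrite !dpE//.
apply: ge0_Lnorm_triangle => //.
- exact: measurable_cut_dist.
- exact: measurable_cut_dist.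
- exact: measurable_cut_dist.
- by move=> a; exact: cut_dist_ge0.
- by move=> a; exact: cut_dist_ge0.
- by move=> a; exact: cut_dist_ge0.
- by move=> a; exact: cut_dist_triangle.
Qed.

(** Each point of the [a]-cut of [u] is a limit of points of the [a]-cut of [v], which is closed by
    upper semicontinuity. *)
Lemma cut_dist_eq0_sub u v (a : R) : (0 < a <= 1)%R -> upper_semicontinuous v ->
  cut_dist u v a = 0 -> forall x, (a <= u x)%R -> (a <= v x)%R.
Proof.
move=> a01 sv; have /andP[a0 _] := a01; rewrite cut_distE// => uv0 x ax.
have /closed_edistP := fuzzy_cut_closed a0 sv.
move=> /(_ x); rewrite fuzzy_cut_gt0//=; apply => e e0.
have /hausdorff_dist_lt : hausdorff_dist (fuzzy_cut u a) (fuzzy_cut v a) < e%:E.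
  by rewrite uv0 lte_fin.
by rewrite !fuzzy_cut_gt0//; exact.
Qed.

Lemma dp_eq0 u v : fuzzy_set u -> fuzzy_set v -> normal_fuzzy u -> normal_fuzzy v ->
  upper_semicontinuous u -> upper_semicontinuous v ->
  dp p u v = 0 -> u = v.
Proof.
move=> fu fv nu nv su sv; rewrite dpE// => uv0.
have : \forall a \ae mu, cut_dist u v a = 0.
  have := @Lnorm_eq0_eq0 _ _ _ mu _ p%:E (measurable_cut_dist su sv) p0 uv0.
  by apply: filterS => a /(_ I).
have le (w1 w2 : V -> R) : fuzzy_set w1 -> fuzzy_set w2 -> upper_semicontinuous w2 ->
    (\forall a \ae mu, cut_dist w1 w2 a = 0) -> forall x, (w1 x <= w2 x)%R.
  (* If [w2 x < w1 x], some level between the two values has cuts at distance zero, yet [x] lies in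
     that cut of [w1] only. *)
  move=> f1 f2 s2 w0 x; rewrite leNgt; apply/negP => w21.
  have [a /andP[a2 a1] wa] := ae_itv_exists w21 w0.
  have a01 : (0 < a <= 1)%R.
    have /andP[w20 _] := f2 x; have /andP[_ w11] := f1 x.
    by rewrite (le_lt_trans w20 a2) (le_trans (ltW a1)).
  by have := cut_dist_eq0_sub a01 s2 wa (ltW a1); rewrite leNgt a2.
move=> ae0; apply/funext => x; apply/eqP; rewrite eq_le !le//.
by rewrite cut_distC.
Qed.

(** Almost every level has its cut at finite distance from the origin, in particular some [b < a];
    the [a]-cut is contained in that [b]-cut. *)
Lemma fuzzy_cut_bounded u (a : R) : normal_fuzzy u -> upper_semicontinuous u ->
  fuzzy_star_Lp p u -> (0 < a <= 1)%R ->
  exists M : R, forall x, (a <= u x)%R -> (edist x 0 <= M)%R.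
Proof.
move=> nu su /fuzzy_star_LpE up /andP[a0 a1].
have mc := measurable_cut_dist su crisp0_usc.
have : \forall b \ae mu, cut_dist u crisp0 b \is a fin_num.
  apply: (Lnorm_fin_ae p0) => //; first by move=> b; exact: cut_dist_ge0.
  by rewrite -dpE//; exact: crisp0_usc.
move=> /(ae_itv_exists a0)[b /andP[b0 ba]].
have b01 : (0 < b <= 1)%R by rewrite b0 (le_trans (ltW ba)).
rewrite cut_distE// fuzzy_cut_crisp0; last by rewrite ltW//; case/andP: b01.
move=> bfin; pose M := fine (hausdorff_dist (fuzzy_cut u b) [set 0%R]).
exists (M + 1)%R => x ax.
have : hausdorff_dist (fuzzy_cut u b) [set 0%R] < (M + 1)%:E.
  by rewrite -(fineK bfin) lte_fin ltrDl.
move=> /hausdorff_dist_lt /(_ x); rewrite fuzzy_cut_gt0//= => /(_ (le_trans (ltW ba) ax)).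
by move=> [_ -> /ltW].
Qed.

Lemma cut_dist_crisp0_sub u v (a : R) : normal_fuzzy u -> normal_fuzzy v ->
  ((0 < a)%R -> fuzzy_cut u a `<=` fuzzy_cut v a) ->
  cut_dist u crisp0 a <= cut_dist v crisp0 a.
Proof.
move=> nu nv uv; have [a01|a01] := boolP (0 < a <= 1)%R; last by rewrite !cut_dist_out.
have /andP[a0 a1] := a01.
have a01' : (0 <= a <= 1)%R by rewrite ltW.
rewrite !cut_distE// fuzzy_cut_crisp0//.
have [y uy] := fuzzy_cut_nonempty a01' nu.
have := hausdorff_dist_ge0 [set 0%R] (fuzzy_cut_nonempty a01' nv).
case vE : (hausdorff_dist _ _) => [r| |]// _; last by rewrite leey.
apply/lee_addgt0Pr => e e0.
have vr : hausdorff_dist (fuzzy_cut v a) [set 0%R] < (r + e)%:E.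
  by rewrite vE lte_fin ltrDl.
apply: hausdorff_dist_le => x.
  by move=> /(uv a0)/(hausdorff_dist_lt vr)[z -> /ltW]; exists 0%R.
move=> ->; exists y => //; rewrite edistC.
by have [z -> /ltW] := hausdorff_dist_lt vr (uv a0 _ uy).
Qed.

(** A bound [M] on the support bounds every cut, so the distance of the cuts to the origin is
    dominated by the constant [M] on []0, 1]]. *)
Lemma Sm_sub_Smp : @Sm R m `<=` @Smp R m p.
Proof.
move=> u [fu nu su [M uM] stu]; split => //.
apply/fuzzy_star_LpE; rewrite dpE//; last exact: crisp0_usc.
have M0 : (0 <= M)%R.
  have [x /uM xM] : fuzzy_cut u 0 !=set0 by apply: fuzzy_cut_nonempty => //;
    rewrite lexx ler01.
  by apply: le_trans xM; exact: edist_ge0.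
pose g : R -> \bar R := (cst M%:E) \_ `]0%R, 1%R].
have mg : measurable_fun [set: R] g by apply/(measurable_restrictT _ _).1.
apply: (@le_lt_trans _ _ 'N[mu]_p%:E[g]).
  apply: ge0_le_Lnorm => //.
  - exact: measurable_cut_dist crisp0_usc.
  - by move=> a; exact: cut_dist_ge0.
  move=> a; have [a01|a01] := boolP (0 < a <= 1)%R; last first.
    by rewrite cut_dist_out// /g patchE; case: ifPn.
  have /andP[a0 a1] := a01.
  rewrite cut_distE// fuzzy_cut_crisp0 ?(ltW a0)//.
  rewrite /g patchE mem_set/=; last by rewrite in_itv.
  have ua : fuzzy_cut u a `<=` fuzzy_cut u 0.
    rewrite fuzzy_cut_gt0// /fuzzy_cut eqxx => x /= ax; apply: subset_closure => /=.
    exact: lt_le_trans ax.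
  apply: hausdorff_dist_le => x.
    by move=> /ua/uM xM; exists 0%R.
  have [y uy] : fuzzy_cut u a !=set0 by apply: fuzzy_cut_nonempty; rewrite ?(ltW a0).
  by move=> ->; exists y => //; rewrite edistC; exact/uM/ua.
rewrite unlock/=; apply: poweR_lty.
have -> : (fun x => `|g x| `^ p) = (cst (M%:E `^ p)) \_ `]0%R, 1%R].
  apply/funext => a; rewrite /g !patchE; case: ifPn => _ /=.
    by rewrite ger0_norm.
  by rewrite normr0 powR0// gt_eqF.
rewrite -integral_mkcond integral_cst//= lebesgue_measure_itv/= lte_fin ltr01.
by rewrite -EFinB -EFinM ltry.
Qed.

Lemma Smp_metric : metric_on (@dp R m p) (@Smp R m p).
Proof.
split.
- move=> u v [_ nu su up _] [_ nv sv vp _]; rewrite dp_ge0/=.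
  apply: le_lt_trans (dp_triangle nu crisp0_normal nv su crisp0_usc sv) _.
  have /fuzzy_star_LpE u0 := up; have /fuzzy_star_LpE v0 := vp.
  by apply: lte_add_pinfty; [exact: u0|rewrite dpC; exact: v0].
- move=> u v [fu nu su _ _] [fv nv sv _ _]; split; first exact: dp_eq0.
  by move=> <-; exact: dpxx.
- by move=> u v _ _; exact: dpC.
- move=> u v w [_ nu su _ _] [_ nv sv _ _] [_ nw sw _ _]; exact: dp_triangle.
Qed.

End pth_power_metric.
End Lp_metric.

(** * Density of [Sm] by truncation at small levels *)

Section density.
Context {R : realType} {m : nat}.
Local Notation V := 'rV[R]_m.
Implicit Types (u : V -> R).
Local Open Scope ereal_scope.
Local Notation mu := (@lebesgue_measure R).

(** Cuts at positive levels below [d] are replaced by the [d]-cut, which is bounded for members of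
    [Smp p]; the higher cuts are unchanged. *)
Definition fuzzy_trunc (d : R) u : V -> R := fun x => (if d <= u x then u x else 0)%R.

Lemma fuzzy_cut_trunc (d a : R) u : (0 < a)%R ->
  fuzzy_cut (fuzzy_trunc d u) a = [set x | (Num.max a d <= u x)%R].
Proof.
move=> a0; rewrite fuzzy_cut_gt0//; apply/seteqP; split => x /=;
  rewrite /fuzzy_trunc ge_max; case: ifPn => // _; rewrite ?andbT ?andbF//.
by rewrite leNgt a0.
Qed.

Section truncation.
Variables (d : R) (u : V -> R).
Hypotheses (d01 : (0 < d <= 1)%R) (fu : fuzzy_set u) (nu : normal_fuzzy u)
  (su : upper_semicontinuous u).

Lemma fuzzy_trunc_fuzzy : fuzzy_set (fuzzy_trunc d u).
Proof. by move=> x; rewrite /fuzzy_trunc; case: ifPn => // _; rewrite lexx ler01. Qed.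

Lemma fuzzy_trunc_normal : normal_fuzzy (fuzzy_trunc d u).
Proof.
have [x ux] := nu; exists x; rewrite /fuzzy_trunc ux.
by case/andP: d01 => _ ->.
Qed.

(** Where [d <= u x], nearby values of the truncation do not exceed those of [u]; where [u x < d],
    the truncation vanishes on a neighbourhood. *)
Lemma fuzzy_trunc_usc : upper_semicontinuous (fuzzy_trunc d u).
Proof.
move=> x a; rewrite {1}/fuzzy_trunc; case: ifPn => [_ ux|].
  apply: filterS (su ux) => y uy; rewrite /fuzzy_trunc; case: ifPn => // _.
  by apply: le_lt_trans uy; case/andP: (fu y).
rewrite -ltNge => ud a0; apply: filterS (su ud) => y uy.
by rewrite /fuzzy_trunc leNgt uy.
Qed.

Lemma fuzzy_trunc_Sm p : (1 <= p)%R -> fuzzy_star_Lp p u -> starshaped_cuts u ->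
  Sm (fuzzy_trunc d u).
Proof.
move=> p1 up stu; have /andP[d0 d1] := d01; split.
- exact: fuzzy_trunc_fuzzy.
- exact: fuzzy_trunc_normal.
- exact: fuzzy_trunc_usc.
- have [M uM] := fuzzy_cut_bounded p1 nu su up d01.
  exists M => x; rewrite /fuzzy_cut eqxx => cx.
  (* The truncation is positive only on the [d]-cut of [u], which is closed and so also contains the
     closure taken at level [0]. *)
  apply: uM; have := fuzzy_cut_closed d0 su; rewrite fuzzy_cut_gt0//; apply.
  apply: closureS cx => y /=; rewrite /fuzzy_trunc; case: ifPn => //.
  by rewrite ltxx.
move=> a /andP[a0 a1]; rewrite fuzzy_cut_trunc//.
have ad0 : (0 < Num.max a d)%R by rewrite lt_max a0.
have /stu : (0 < Num.max a d <= 1)%R by rewrite ad0 ge_max a1.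
by rewrite fuzzy_cut_gt0.
Qed.

Lemma cut_dist_trunc_eq0 (a : R) : (d <= a)%R -> cut_dist u (fuzzy_trunc d u) a = 0.
Proof.
move=> da; have [a01|a01] := boolP (0 < a <= 1)%R; last by rewrite cut_dist_out.
have /andP[a0 a1] := a01.
rewrite cut_distE// fuzzy_cut_trunc// max_l// -fuzzy_cut_gt0// hausdorff_distxx//.
by apply: fuzzy_cut_nonempty; rewrite ?(ltW a0).
Qed.

(** Triangle inequality through the origin, truncation only shrinking the cuts. The bound is
    independent of [d], as dominated convergence requires. *)
Lemma cut_dist_trunc_le (a : R) :
  cut_dist u (fuzzy_trunc d u) a <= cut_dist u crisp0 a + cut_dist u crisp0 a.
Proof.
apply: (le_trans (cut_dist_triangle (v := crisp0) _ nu crisp0_normal fuzzy_trunc_normal)).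
apply: leeD => //; rewrite cut_distC; apply: cut_dist_crisp0_sub => //.
  exact: fuzzy_trunc_normal.
move=> a0; rewrite fuzzy_cut_trunc// fuzzy_cut_gt0// => x /=.
by rewrite ge_max => /andP[].
Qed.

End truncation.

Lemma Sm_dense (p : R) : (1 <= p)%R -> dense_in (@dp R m p) (@Sm R m) (@Smp R m p).
Proof.
move=> p1 u [fu nu su up stu] e e0; have p0 : (0 < p)%R by exact: lt_le_trans p1.
pose d n : R := n.+1%:R^-1%R.
have d01 n : (0 < d n <= 1)%R by rewrite invr_gt0 ltr0n/= invf_le1// ler1n.
have sc : upper_semicontinuous (@crisp0 R m) := @crisp0_usc R m.
have st n : upper_semicontinuous (fuzzy_trunc (d n) u) by exact: fuzzy_trunc_usc.
pose g (a : R) := cut_dist u crisp0 a + cut_dist u crisp0 a.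
have g0 a : 0 <= g a by rewrite adde_ge0// cut_dist_ge0.
have mc : measurable_fun [set: R] (cut_dist u crisp0) by exact: measurable_cut_dist.
have mg : measurable_fun [set: R] g by exact: emeasurable_funD.
have mgp : measurable_fun [set: R] (fun a => `|g a| `^ p).
  by apply: (measurableT_comp (measurable_poweR _)); exact: measurableT_comp.
have gfin : 'N[mu]_p%:E[g] < +oo.
  apply: (@le_lt_trans _ _
      ('N[mu]_p%:E[cut_dist u crisp0] + 'N[mu]_p%:E[cut_dist u crisp0])).
    by apply: ge0_minkowski => // a; exact: cut_dist_ge0.
  have /fuzzy_star_LpE := up; rewrite dpE// => u0.
  by apply: lte_add_pinfty; exact: u0.
have ig : mu.-integrable setT (fun a => `|g a| `^ p).
  apply/integrableP; split=> //.
  under eq_integral do rewrite gee0_abs ?poweR_ge0//.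
  by rewrite -poweR_Lnorm ?gt_eqF// poweR_lty.
pose f n (a : R) := `|cut_dist u (fuzzy_trunc (d n) u) a| `^ p.
have mf n : measurable_fun [set: R] (f n).
  apply: (measurableT_comp (measurable_poweR _)); apply: measurableT_comp => //.
  exact: measurable_cut_dist.
(* At a level [a > 0] the cut is unchanged as soon as [d n <= a], so the sequence is eventually
   zero; for [a <= 0] it is zero by convention. *)
have f_cvg : {ae mu, forall a, setT a -> f ^~ a @ \oo --> (0 : \bar R)}.
  apply: aeW => a _; apply: cvg_near_cst.
  have [a0|a0] := ltP 0%R a; last first.
    apply: nearW => n; rewrite /f cut_dist_out; first by rewrite abse0 poweR0r// gt_eqF.
    by rewrite ltNge a0.
  near=> n; rewrite /f cut_dist_trunc_eq0//; first by rewrite abse0 poweR0r// gt_eqF.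
  by apply: ltW; near: n; exact: near_infty_natSinv_lt (PosNum a0).
have fg : {ae mu, forall a n, setT a -> `|f n a| <= `|g a| `^ p}.
  apply: aeW => a n _; rewrite gee0_abs ?poweR_ge0// /f.
  rewrite gee0_abs ?cut_dist_ge0// gee0_abs//.
  by rewrite ge0_le_poweR ?(ltW p0) ?cut_dist_ge0// cut_dist_trunc_le.
have int_cvg : \int[mu]_x f n x @[n --> \oo] --> \int[mu]_x (cst 0 x : \bar R).
  by have [] := @dominated_convergence _ _ _ mu setT measurableT f (cst 0) _ mf
    (measurable_cst _) f_cvg ig fg.
have ep0 : 0 < e%:E `^ p by rewrite poweR_gt0// lte_fin.
have [n nfe] : exists n, \int[mu]_x f n x < e%:E `^ p.
  have : \forall n \near \oo, \int[mu]_x f n x < e%:E `^ p.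
    rewrite integral0 in int_cvg.
    have /int_cvg : nbhs (0 : \bar R) [set y | y < e%:E `^ p].
      by apply: open_nbhs_nbhs; split; [exact: open_ereal_lt_ereal|].
    by [].
  by move=> /filter_ex.
exists (fuzzy_trunc (d n) u); first exact: (fuzzy_trunc_Sm _ _ _ _ p1).
rewrite ltNge; apply/negP => en; move: nfe; apply/negP; rewrite -leNgt.
have -> : \int[mu]_x f n x = 'N[mu]_p%:E[cut_dist u (fuzzy_trunc (d n) u)] `^ p.
  by rewrite poweR_Lnorm// gt_eqF.
by rewrite -dpE// ge0_le_poweR// ltW.
Unshelve. all: by end_near. Qed.

End density.

(** * Kuratowski limits of Hausdorff-Cauchy sequences of sets *)

Section kuratowski.
Context {R : realType} {m : nat}.
Local Notation V := 'rV[R]_m.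
Implicit Types (A : nat -> set V) (x y z c : V).

Lemma edist_convex (t : R) x y x' y' : 0 <= t <= 1 ->
  edist ((1 - t) *: x + t *: y) ((1 - t) *: x' + t *: y') <=
  (1 - t) * edist x x' + t * edist y y'.
Proof.
move=> /andP[t0 t1].
have scale (s : R) v w z : 0 <= s -> edist (s *: v + z) (s *: w + z) = s * edist v w.
  move=> s0; rewrite /edist -[in RHS](ger0_norm s0) -sqrtr_sqr -sqrtrM ?sqr_ge0//.
  by congr Num.sqrt; rewrite mulr_sumr; apply: eq_bigr => i _; rewrite !mxE; ring.
apply: le_trans (edist_triangle ((1 - t) *: x' + t *: y) _ _) _.
rewrite scale ?subr_ge0// lerD2l addrC (addrC _ (t *: y')) scale//.
Qed.

(** The Kuratowski upper limit of the sequence. *)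
Definition set_limsup A : set V :=
  [set x | forall e : R, 0 < e -> forall N : nat, exists2 k : nat, (N <= k)%N &
    exists2 y, A k y & edist x y < e].

Lemma set_limsup_closed A : closed (set_limsup A).
Proof.
apply/closed_edistP => x xA e e0 N.
have e20 : 0 < e / 2 by rewrite divr_gt0.
have [y /(_ _ e20 N)[k Nk [z Az yz]] xy] := xA _ e20.
exists k => //; exists z => //.
by rewrite (splitr e) (le_lt_trans (edist_triangle y _ _))// ltrD.
Qed.

Lemma bounded_seq_cluster (c : nat -> V) x (r : R) (N0 : nat) :
  (forall k, (N0 <= k)%N -> edist x (c k) <= r) ->
  exists2 y, edist x y <= r &
    forall e : R, 0 < e -> forall N : nat, exists2 k : nat, (N <= k)%N & edist y (c k) < e.
Proof.
move=> cr; have := @compact_eball _ _ x r (c @ \oo).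
have cK : (c @ \oo) [set y | edist x y <= r] by exists N0.
move=> /(_ _ cK)[y [xy cy]]; exists y => // e e0 N.
have cN : (c @ \oo) [set c k | k in [set k | (N <= k)%N]].
  by exists N => // k /= Nk; exists k.
have ye : nbhs y [set z | edist y z < e] by apply/nbhs_edistP; exists e.
by have [_ [[k /= Nk <-] yk]] := cy _ _ cN ye; exists k.
Qed.

Definition hausdorff_cauchy A := forall e : R, 0 < e ->
  exists N : nat, forall i j : nat, (N <= i)%N -> (N <= j)%N ->
    (hausdorff_dist (A i) (A j) < e%:E)%E.

Lemma geometric_hausdorff_cauchy A (N : nat) : (forall k, A k !=set0) ->
  (forall k, (N <= k)%N -> (hausdorff_dist (A k) (A k.+1) < (2^-1 ^+ k)%:E)%E) ->
  hausdorff_cauchy A.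
Proof.
move=> A0 AN.
pose q k : R := 2^-1 ^+ k.
have q0 k : 0 < q k by rewrite exprn_gt0// invr_gt0.
have qS k : q k = 2 * q k.+1 by rewrite /q exprS mulrA divff// mul1r.
(* The right-hand side is the closed form of the geometric sum [q i + ... + q (i + d - 1)], which
   suits induction on [d]. *)
have AD i d : (N <= i)%N ->
    (hausdorff_dist (A i) (A (i + d)%N) <= (2 * (q i - q (i + d)%N))%:E)%E.
  move=> Ni; elim: d => [|d IHd]; first by rewrite addn0 subrr mulr0 hausdorff_distxx.
  apply: (le_trans (hausdorff_dist_triangle (A0 i) (A0 (i + d)%N) (A0 _))).
  have -> : 2 * (q i - q (i + d.+1)%N) = 2 * (q i - q (i + d)%N) + q (i + d)%N.
    by rewrite addnS (qS (i + d)%N); ring.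
  rewrite EFinD leeD// addnS ltW// AN// (leq_trans Ni)// leq_addr//.
have ADle i d : (N <= i)%N -> (hausdorff_dist (A i) (A (i + d)%N) <= (2 * q i)%:E)%E.
  move=> Ni; apply: le_trans (AD _ _ Ni) _; rewrite lee_fin ler_pM2l// lerBlDr.
  by rewrite lerDl ltW.
move=> e e0.
have [M qM] : exists M, 2 * q M < e.
  have e20 : 0 < e / 2 by rewrite divr_gt0.
  have /cvgr0Pnorm_lt /(_ _ e20) : q @ \oo --> (0 : R).
    by apply: cvg_expr; rewrite ger0_norm ?invr_ge0// invf_lt1// ltr1n.
  move=> /filter_ex[M]; rewrite ger0_norm ?ltW// => qM; exists M.
  by rewrite mulrC -ltr_pdivlMr.
have q_noninc i j : (i <= j)%N -> q j <= q i.
  by move=> ij; apply: ler_wiXn2l => //; rewrite ?invr_ge0// invf_le1// ler1n.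
have lt i d : (maxn N M <= i)%N -> (hausdorff_dist (A i) (A (i + d)%N) < e%:E)%E.
  rewrite geq_max => /andP[Ni Mi]; apply: le_lt_trans (ADle _ _ Ni) _.
  by rewrite lte_fin (le_lt_trans _ qM)// ler_pM2l// q_noninc.
exists (maxn N M) => i j Ni Nj; have [ij|/ltnW ji] := leqP i j.
  by rewrite -(subnKC ij) lt.
by rewrite hausdorff_distC -(subnKC ji) lt.
Qed.

(** A point of [A k] has companions within [e / 2] in all late sets, and a cluster point of these
    lies in the upper limit. Conversely a point of the upper limit is close to some late [A j],
    hence to [A k]. *)
Lemma hausdorff_cauchy_cvg A : hausdorff_cauchy A -> forall e : R, 0 < e ->
  exists N : nat, forall k, (N <= k)%N ->
    (hausdorff_dist (A k) (set_limsup A) <= e%:E)%E.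
Proof.
move=> cA e e0; have e20 : 0 < e / 2 by rewrite divr_gt0.
have [N AN] := cA _ e20; exists N => k Nk; apply: hausdorff_dist_le => x Ax.
(* For [j < N] the value [0] is a dummy making the choice total. *)
- have close j : {y | (N <= j)%N -> A j y /\ edist x y < e / 2}.
    apply: cid; have [Nj|jN] := leqP N j; last by exists 0.
    by have [y Ay xy] := hausdorff_dist_lt (AN _ _ Nk Nj) Ax; exists y.
  pose y j := sval (close j).
  have yA j : (N <= j)%N -> A j (y j) /\ edist x (y j) < e / 2.
    exact: (svalP (close j)).
  have [z xz zy] : exists2 z, edist x z <= e / 2 & forall e : R, 0 < e ->
      forall N : nat, exists2 k : nat, (N <= k)%N & edist z (y k) < e.
    by apply: (@bounded_seq_cluster _ _ _ N) => j /yA[_ /ltW].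
  exists z; last by rewrite (le_trans xz)// ler_pdivrMr// ler_peMr ?(ltW e0)// ler1n.
  move=> d d0 M; have [j] := zy _ d0 (maxn N M).
  rewrite geq_max => /andP[Nj Mj] zj; exists j => //; exists (y j) => //.
  by have [] := yA _ Nj.
- have [j Nj [y Ay xy]] := Ax _ e20 N.
  have [z Az yz] := hausdorff_dist_lt (AN _ _ Nj Nk) Ay.
  exists z => //; rewrite (splitr e) (le_trans (edist_triangle y _ _))//.
  by rewrite lerD// ltW.
Qed.

Definition starshaped (A : set V) :=
  exists2 c, A c & forall y, A y -> line_segment c y `<=` A.

(* Any cluster point of the centres is a centre of the Kuratowski limit. *)
Lemma kuratowski_limit_starshaped A (L : set V) (M : R) (N0 : nat) :
  (forall k, starshaped (A k)) ->
  (forall k y, (N0 <= k)%N -> A k y -> edist 0 y <= M) ->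
  set_limsup A `<=` L ->
  (forall y, L y -> forall e : R, 0 < e -> exists N : nat, forall k, (N <= k)%N ->
    exists2 z, A k z & edist y z < e) ->
  starshaped L.
Proof.
move=> starA bA AL LA.
have {}starA k : exists c, A k c /\ forall y, A k y -> line_segment c y `<=` A k.
  by have [c Ac cA] := starA k; exists c.
have [c cA] := choice starA.
have [c0 _ c0c] : exists2 z, edist 0 z <= M & forall e : R, 0 < e ->
    forall N : nat, exists2 k : nat, (N <= k)%N & edist z (c k) < e.
  by apply: (@bounded_seq_cluster _ _ _ N0) => k Nk; apply: (bA k) => //; case: (cA k).
exists c0.
  apply: AL => e e0 N; have [k Nk ck] := c0c _ e0 N.
  by exists k => //; exists (c k) => //; case: (cA k).
move=> y Ly w [t]; rewrite /= in_itv/= => t01 <-; apply: AL => e e0 N.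
have [N' AN'] := LA _ Ly _ e0.
have [k] := c0c _ e0 (maxn N N'); rewrite geq_max => /andP[Nk N'k] ck.
have [z Az yz] := AN' _ N'k.
exists k => //; exists ((1 - t) *: c k + t *: z).
  have [_ /(_ _ Az)] := cA k; apply; exists t => //=.
apply: (le_lt_trans (edist_convex _ _ _ _ t01)).
have /andP[t0 t1] := t01.
(* At [t = 0] strictness comes from the centres alone; for [t > 0] it comes from [yz]. *)
move: t0; rewrite le_eqVlt => /predU1P[<-|t0]; first by rewrite subr0 mul1r mul0r addr0.
rewrite [ltRHS](_ : e = (1 - t) * e + t * e); last by ring.
by rewrite ler_ltD ?ler_wpM2l ?subr_ge0 ?(ltW ck)// ltr_pM2l.
Qed.

Lemma hausdorff_cauchy_bounded A (M : R) N :
  (forall i, (N <= i)%N -> (hausdorff_dist (A i) (A N) < 1%:E)%E) ->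
  (forall y, A N y -> edist y 0 <= M) ->
  forall k y, (N <= k)%N -> A k y -> edist 0 y <= M + 1.
Proof.
move=> AN bM k y Nk Ay; rewrite edistC.
have [z /bM z0 yz] := hausdorff_dist_lt (AN _ Nk) Ay.
by rewrite (le_trans (edist_triangle z _ _))// addrC lerD// ltW.
Qed.

Lemma set_limsup_bounded A (M : R) (N : nat) :
  (forall k y, (N <= k)%N -> A k y -> edist 0 y <= M) ->
  forall y, set_limsup A y -> edist 0 y <= M.
Proof.
move=> bA y Ay; apply/ler_addgt0Pr => e e0; have [k Nk [z Az yz]] := Ay _ e0 N.
by rewrite (le_trans (edist_triangle z _ _))// lerD ?(bA k)// edistC ltW.
Qed.

(** The Cauchy property makes every point of the upper limit approximable from all late sets, so the
    upper limit is a full Kuratowski limit. *)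
Lemma set_limsup_starshaped A (M : R) (N : nat) : hausdorff_cauchy A ->
  (forall k, starshaped (A k)) ->
  (forall k y, (N <= k)%N -> A k y -> edist 0 y <= M) ->
  starshaped (set_limsup A).
Proof.
move=> cA starA bA; apply: (kuratowski_limit_starshaped starA bA) => // y Ay e e0.
have e20 : 0 < e / 2 by rewrite divr_gt0.
have [N' AN'] := cA _ e20; exists N' => k N'k.
have [j Nj [z Az yz]] := Ay _ e20 N'.
have [w Aw zw] := hausdorff_dist_lt (AN' _ _ Nj N'k) Az.
exists w => //; rewrite (splitr e) (le_lt_trans (edist_triangle z _ _))//.
exact: ltrD.
Qed.

End kuratowski.

(** * Rebuilding a fuzzy set from a decreasing family of closed sets *)

Section level_function.
Context {R : realType} {m : nat}.
Local Notation V := 'rV[R]_m.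
Variable K : R -> set V.
Hypothesis K_noninc : forall a b, a <= b -> K b `<=` K a.
Hypothesis K_closed : forall b, closed (K b).

(** Including [0] in the set gives the value [0] at points that lie in no [K b] with
    [0 < b <= 1]. *)
Definition level_fun : V -> R :=
  fun x => sup [set b | b = 0 \/ (0 < b <= 1 /\ K b x)].

Definition level_cap (a : R) : set V := [set x | forall b, 0 < b < a -> K b x].

Let ub1 x : ubound [set b | b = 0 \/ (0 < b <= 1 /\ K b x)] 1.
Proof. by move=> b [->//|[/andP[]]]. Qed.

Let hs x : has_sup [set b | b = 0 \/ (0 < b <= 1 /\ K b x)].
Proof. by split; [exists 0; left|exists 1; exact: ub1]. Qed.

Lemma level_fun_fuzzy : fuzzy_set level_fun.
Proof.
move=> x; apply/andP; split; last by apply: ge_sup; [exists 0; left|exact: ub1].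
by apply: ub_le_sup; [exists 1; exact: ub1|left].
Qed.

(** The supremum need not be attained: a point of value [a] may lie in [K b] only for [b < a],
    whence an intersection over smaller levels instead of [K a]. *)
Lemma level_fun_cut (a : R) : 0 < a <= 1 -> fuzzy_cut level_fun a = level_cap a.
Proof.
move=> /andP[a0 a1]; rewrite fuzzy_cut_gt0//; apply/seteqP; split => x /= ax.
  move=> b /andP[b0 ba].
  have [c [->|[c01 Kc]] bc] := sup_gt (hs x).1 (lt_le_trans ba ax).
    by move: bc; rewrite ltNge (ltW b0).
  exact: K_noninc (ltW bc) _ Kc.
rewrite leNgt; apply/negP => xa.
have /andP[x0 _] := level_fun_fuzzy x.
have [b /andP[xb ba]] : exists b, level_fun x < b < a.
  by exists ((level_fun x + a) / 2); rewrite midf_lt// midf_lt.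
have b0 : 0 < b by exact: le_lt_trans xb.
have : b <= level_fun x.
  apply: ub_le_sup; first by exists 1; exact: ub1.
  by right; rewrite b0 (le_trans (ltW ba) a1); split=> //; apply: ax; rewrite b0.
by rewrite leNgt xb.
Qed.

(** For [b] strictly between the value at [x] and [a], the complement of [K b] is an open
    neighbourhood of [x], on which monotonicity of [K] keeps the values at most [b]. *)
Lemma level_fun_usc : upper_semicontinuous level_fun.
Proof.
move=> x a xa; have /andP[x0 x1] := level_fun_fuzzy x.
have a0 := le_lt_trans x0 xa.
have [b /andP[xb ba]] : exists b, level_fun x < b < a.
  by exists ((level_fun x + a) / 2); rewrite midf_lt// midf_lt.
have b0 : 0 < b by exact: le_lt_trans xb.
(* Levels above [1] do not enter the supremum, so for them the bound of all values by [1] is used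
   instead of [K b]. *)
have [b1|b1] := ltP 1 b.
  apply/nbhs_edistP; exists 1 => // y _.
  by have /andP[_ y1] := level_fun_fuzzy y; rewrite (le_lt_trans y1)// (lt_trans b1).
have nKx : (~` K b) x.
  move=> Kx; have : b <= level_fun x.
    by apply: ub_le_sup; [exists 1; exact: ub1|right; rewrite b0 b1].
  by rewrite leNgt xb.
have : nbhs x (~` K b).
  by apply: open_nbhs_nbhs; split => //; exact: closed_openC.
apply: filterS => y nKy; apply: le_lt_trans ba.
apply: ge_sup; first by exists 0; left.
move=> c [->|[_ Kc]]; first exact: ltW.
by rewrite leNgt; apply/negP => /ltW /K_noninc /(_ _ Kc).
Qed.

(* Where [level_cap] and [K] differ at [a], some ball with rational centre and
   radius [1/n] meets [K b] exactly for [b < a], so that [a] is one of countably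
   many suprema. *)
Lemma level_cap_countable :
  countable [set a | 0 < a <= 1 /\ level_cap a <> K a].
Proof.
pose B (q : 'rV[rat]_m * nat) : set V :=
  [set y | forall i, `|ratr (q.1 0 i) - y 0 i| < q.2.+1%:R^-1].
pose s q := sup [set b | 0 < b <= 1 /\ (K b `&` B q) !=set0].
apply: (@sub_countable _ _ _ (range s)); last first.
  by apply: (sub_countable (card_image_le s setT)); exact: countableP.
apply: subset_card_le => a [/andP[a0 a1] aK].
have [x [ax nKx]] : exists x, level_cap a x /\ ~ K a x.
  apply: contrapT => /forallNP noX; apply: aK; apply/seteqP; split => x.
    by move=> ax; apply: contrapT => nKx; exact: (noX x).
  by move=> Kx b /andP[_ /ltW ba]; exact: K_noninc ba _ Kx.
have : nbhs x (~` K a).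
  by apply: open_nbhs_nbhs; split => //; exact: closed_openC.
move=> /nbhs_ballP[e /= e0 eK].
(* Two coordinate errors, from a point of the box to its rational centre and from there to [x], must
   add up to less than [e]. *)
have [n ne] : exists n : nat, n.+1%:R^-1 < e / 2.
  by have := near_infty_natSinv_lt (PosNum (divr_gt0 e0 (ltr0Sn R 1))) => /filter_ex.
have rat_near i : exists q : rat, `|ratr q - x 0 i| < n.+1%:R^-1.
  have : x 0 i - n.+1%:R^-1 < x 0 i + n.+1%:R^-1.
    by rewrite ltrD2l gtrN// invr_gt0.
  move=> /rat_in_itvoo[q]; rewrite in_itv/= => qx; exists q.
  by rewrite distrC ltr_distlC.
have [q qx] := choice rat_near.
exists (\row_i q i, n) => //.
have xB : B (\row_i q i, n) x by move=> i /=; rewrite mxE.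
have BK : B (\row_i q i, n) `<=` ~` K a.
  move=> y yB; apply: eK; split => // i j; rewrite (ord1 i).
  have := yB j; have := qx j; rewrite /= mxE /ball/= => h1 h2.
  rewrite (le_lt_trans (ler_distD (ratr (q j)) _ _))//.
  by rewrite (splitr e) ltrD//; [rewrite distrC|]; exact: lt_trans ne.
have ub : ubound [set b | 0 < b <= 1 /\ K b `&` B (\row_i q i, n) !=set0] a.
  move=> b [_ [y [Ky /BK nKy]]]; rewrite leNgt; apply/negP => /ltW /K_noninc /(_ _ Ky).
  exact: nKy.
apply/eqP; rewrite eq_le; apply/andP; split.
  apply: ge_sup => //; exists (a / 2); split.
    by rewrite divr_gt0//= ler_pdivrMr// mul1r (le_trans a1)// ler1n.
  by exists x; split => //; apply: ax; rewrite divr_gt0//= ltr_pdivrMr// ltr_pMr// ltr1n.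
rewrite leNgt; apply/negP => sa.
have s0 : 0 <= s (\row_i q i, n).
  apply: (@le_trans _ _ (a / 2)); first by rewrite divr_ge0// ltW.
  apply: ub_le_sup; first by exists a.
  split; first by rewrite divr_gt0//= ler_pdivrMr// mul1r (le_trans a1)// ler1n.
  by exists x; split => //; apply: ax; rewrite divr_gt0//= ltr_pdivrMr// ltr_pMr// ltr1n.
(* A level strictly between the supremum and [a] would belong to the set and exceed its supremum. *)
pose b := (s (\row_i q i, n) + a) / 2.
have sb : s (\row_i q i, n) < b by rewrite midf_lt.
have ba : b < a by rewrite midf_lt.
have b0 : 0 < b by exact: le_lt_trans sb.
have : b <= s (\row_i q i, n).
  apply: ub_le_sup; first by exists a.
  split; first by rewrite b0 (le_trans (ltW ba)).
  by exists x; split => //; apply: ax; rewrite b0.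
by rewrite leNgt sb.
Qed.

(** Levels [b n < a] satisfying [P] are chosen tending to [a]; [level_cap a] is then the Kuratowski
    limit of the star-shaped sets [K (b n)]. *)
Lemma level_cap_starshaped (P : R -> Prop) (a : R) : 0 < a <= 1 ->
  (\forall b \ae @lebesgue_measure R, P b) ->
  (forall b, 0 < b <= 1 -> P b -> starshaped (K b) /\
    exists M : R, forall y, K b y -> edist 0 y <= M) ->
  starshaped (level_cap a).
Proof.
move=> /andP[a0 a1] aeP PK.
have a20 : 0 < a / 2 by rewrite divr_gt0.
have a2a : a / 2 < a by rewrite ltr_pdivrMr// ltr_pMr// ltr1n.
(* This level lies below [a / 2], hence below every [b n], so the bounded set [K g] contains all the
   [K (b n)]. *)
have [g /andP[g0 ga] Pg] := ae_itv_exists a20 aeP.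
have [_ [M KM]] : starshaped (K g) /\ exists M : R, forall y, K g y -> edist 0 y <= M.
  by apply: PK => //; rewrite g0 (le_trans (ltW ga))// (le_trans (ltW a2a)).
have seqP (n : nat) : exists b, [/\ a / 2 < b, a - n.+1%:R^-1 < b, b < a & P b].
  have : Num.max (a / 2) (a - n.+1%:R^-1) < a.
    by rewrite gt_max a2a ltrBlDr ltrDl invr_gt0 ltr0n.
  move=> /ae_itv_exists /(_ aeP)[b /andP[]]; rewrite gt_max => /andP[b1 b2] b3 Pb.
  by exists b.
have [b bP] := choice seqP.
apply: (@kuratowski_limit_starshaped _ _ (fun n => K (b n)) _ M 0%N).
- move=> n; have [b1 _ b3 Pb] := bP n.
  by have [] := PK (b n) _ Pb; rewrite // (lt_trans a20 b1) (le_trans (ltW b3)).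
- move=> n y _; have [b1 _ _ _] := bP n => Ky; apply: KM.
  by apply: K_noninc Ky; rewrite (le_trans (ltW ga))// ltW.
(* For [c < a] the late levels [b n] exceed [c], so points of the upper limit are limits of points
   of the closed set [K c]. *)
- move=> x xK c /andP[c0 ca]; have /closed_edistP := @K_closed c; apply => e e0.
  have [N Nc] : exists N : nat, N.+1%:R^-1 < a - c.
    have ac0 : 0 < a - c by rewrite subr_gt0.
    by have := near_infty_natSinv_lt (PosNum ac0) => /filter_ex.
  have [n Nn [y Ky xy]] := xK _ e0 N; exists y => //.
  apply: K_noninc Ky; have [_ b2 _ _] := bP n.
  apply: ltW; apply: lt_trans b2; rewrite ltrBrDl -ltrBrDr.
  by apply: le_lt_trans Nc; rewrite lef_pV2 ?posrE// ler_nat.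
- move=> y Ly e e0; exists 0%N => n _; exists y; last by rewrite edistxx.
  by have [b1 _ b3 _] := bP n; apply: Ly; rewrite (lt_trans a20 b1).
Qed.

End level_function.

(** * Completeness of [Smp p] *)

Section completeness.
Context {R : realType} {m : nat}.
Local Notation V := 'rV[R]_m.
Local Notation mu := (@lebesgue_measure R).
Variable p : R.
Hypothesis p1 : 1 <= p.
Let p0 : 0 < p. Proof. exact: lt_le_trans p1. Qed.
Local Open Scope ereal_scope.

Lemma cauchy_geometric_subseq (T : Type) (dist : T -> T -> \bar R) (s : nat -> T) :
  cauchy_seq dist s -> exists f : nat -> nat,
    (forall k, (k <= f k)%N) /\
    forall k, dist (s (f k)) (s (f k.+1)) <= ((4^-1) ^+ k)%:E.
Proof.
move=> cs.
have N_ k : exists N : nat, forall i j : nat, (N <= i)%N -> (N <= j)%N ->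
    dist (s i) (s j) < ((4^-1) ^+ k)%:E.
  by apply: cs; rewrite exprn_gt0// invr_gt0.
have [N NP] := choice N_.
(* The sum makes the indices at [k] and at [k.+1] both at least [N k], and the summand [k] makes the
   index at least [k]. *)
exists (fun k => (k + \sum_(i < k.+1) N i)%N); split=> [k|k]; first exact: leq_addr.
have Nle j : (k < j)%N -> (N k <= \sum_(i < j) N i)%N.
  by move=> kj; rewrite (bigD1 (Ordinal kj))//= leq_addr.
by apply/ltW/NP; apply: leq_trans (leq_addl _ _); apply: Nle.
Qed.

Lemma Smp_complete : complete_on (@dp R m p) (@Smp R m p).
Proof.
move=> s Ys cs.
have fs n : fuzzy_set (s n) by have [] := Ys n.
have ns n : normal_fuzzy (s n) by have [] := Ys n.
have ss n : upper_semicontinuous (s n) by have [] := Ys n.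
have [f [lef fdist]] := cauchy_geometric_subseq cs.
pose A (b : R) k := [set x | (b <= s (f k) x)%R].
have AE (b : R) k : (0 < b)%R -> A b k = fuzzy_cut (s (f k)) b.
  by move=> b0; rewrite fuzzy_cut_gt0.
pose K (b : R) : set V := set_limsup (A b).
have K_noninc a b : (a <= b)%R -> K b `<=` K a.
  move=> ab x xK e e0 N; have [k Nk [y by_ xy]] := xK e e0 N.
  by exists k => //; exists y => //; exact: le_trans by_.
have K_closed b : closed (K b) by exact: set_limsup_closed.
pose P (b : R) := (0 < b <= 1)%R -> hausdorff_cauchy (A b).
have aeP : \forall b \ae mu, P b.
  pose h k := cut_dist (s (f k)) (s (f k.+1)).
  have hlt : \forall b \ae mu, \forall k \near \oo, h k b < ((2^-1) ^+ k)%:E.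
    apply: (Lnorm_summable_ae p1) => [k|k b|k].
    - exact: measurable_cut_dist.
    - exact: cut_dist_ge0.
    - by rewrite -dpE.
  apply: (@filterS _ _ (ae_filter_ringOfSetsType mu) _ _ _ hlt) => b [N _ hN] b01.
  have /andP[b0 b1] := b01.
  apply: (@geometric_hausdorff_cauchy _ _ _ N) => [k|k Nk].
    by rewrite AE//; apply: fuzzy_cut_nonempty; rewrite ?(ltW b0).
  by have := hN k Nk; rewrite /h cut_distE// -!AE.
have K_star b : (0 < b <= 1)%R -> P b -> starshaped (K b) /\
    exists M : R, forall y, K b y -> (edist 0 y <= M)%R.
  move=> b01 /(_ b01) cA; have /andP[b0 b1] := b01.
  have [N /(_ _ N) AN] := cA 1%R ltr01.
  have [_ nN sN LN _] := Ys (f N).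
  have [M sM] := fuzzy_cut_bounded p1 nN sN LN b01.
  have bA := hausdorff_cauchy_bounded (fun i Ni => AN i Ni (leqnn N)) sM.
  split; last by exists (M + 1)%R; exact: set_limsup_bounded bA.
  apply: (set_limsup_starshaped cA) bA => k.
  by have [_ _ _ _ /(_ _ b01)] := Ys (f k); rewrite -AE.
pose u := level_fun K.
have fu : fuzzy_set u := level_fun_fuzzy K.
have su : upper_semicontinuous u := level_fun_usc K_noninc K_closed.
have star_u (a : R) : (0 < a <= 1)%R -> starshaped (fuzzy_cut u a).
  move=> a01; rewrite /u level_fun_cut//.
  exact: (level_cap_starshaped K_noninc K_closed a01 aeP K_star).
have nu : normal_fuzzy u.
  (* Star-shapedness includes a centre, so the cut at level [1] is nonempty. *)
  have [x] : starshaped (fuzzy_cut u 1) by apply: star_u; rewrite ltr01 lexx.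
  rewrite fuzzy_cut_gt0//= => ux _; exists x; apply/eqP; rewrite eq_le ux andbT.
  by have /andP[] := fu x.
have aeK : \forall a \ae mu, (0 < a <= 1)%R -> level_cap K a = K a.
  exists [set a | (0 < a <= 1)%R /\ level_cap K a <> K a]; split.
  - exact: countable_measurable (level_cap_countable K_noninc K_closed).
  - exact: countable_lebesgue_measure0 (level_cap_countable K_noninc K_closed).
  by move=> a /= /not_implyP.
(* Fatou in [k] with [n] fixed: the distances from [s n] to [s (f k)] are eventually at most [e],
   and at almost every level the cuts of [s (f k)] converge to that of [u]. This bounds the whole
   sequence, not only the subsequence. *)
have cvgu (e : R) : (0 < e)%R ->
    exists N : nat, forall n, (N <= n)%N -> dp p (s n) u <= e%:E.
  move=> e0; have [N sN] := cs _ e0; exists N => n Nn; rewrite dpE//.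
  apply: (@ge0_Lnorm_fatou _ _ _ mu p e _ (fun k => cut_dist (s n) (s (f k)))) => //.
  - exact: ltW.
  - exact: measurable_cut_dist.
  - by move=> k; exact: measurable_cut_dist.
  - by move=> a; exact: cut_dist_ge0.
  - by move=> k a; exact: cut_dist_ge0.
  - apply: (@filterS2 _ _ (ae_filter_ringOfSetsType mu) _ _ _ _ aeP aeK) => a Pa aK c.
    have [a01|a01] := boolP (0 < a <= 1)%R; last first.
      by rewrite cut_dist_out// => c0; apply: nearW => k; rewrite cut_dist_out// ltW.
    have /andP[a0 a1] := a01.
    move=> cf.
    (* The slack [d] above [c] exists also when the distance to [u] is infinite. Once the [a]-cut of
       [s (f k)] is within [d] of that of [u], the triangle inequality keeps its distance to the cut
       of [s n] at least [c]. *)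
    have [d d0 cd] : exists2 d : R, (0 < d)%R & (c + d)%:E <= cut_dist (s n) u a.
      move: cf; case: (cut_dist _ _ _) => [r| |]//.
        by rewrite lte_fin => cr; exists (r - c)%R; rewrite ?subr_gt0// subrKC.
      by move=> _; exists 1%R => //; rewrite leey.
    have d20 : (0 < d / 2)%R by rewrite divr_gt0.
    have [M AM] := hausdorff_cauchy_cvg (Pa a01) d20.
    exists M => // k /= /AM AK; rewrite leNgt; apply/negP => fc.
    have kd : cut_dist (s (f k)) u a <= d%:E.
      rewrite cut_distE// /u level_fun_cut// aK// -AE// (le_trans AK)//.
      by rewrite lee_fin ler_pdivrMr// ler_peMr ?(ltW d0)// ler1n.
    have : cut_dist (s n) u a < (c + d)%:E.
      apply: le_lt_trans (cut_dist_triangle (v := s (f k)) _ (ns n) (ns _) nu) _.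
      apply: (@le_lt_trans _ _ (cut_dist (s n) (s (f k)) a + d%:E)); first exact: leeD.
      by rewrite EFinD; apply: lte_leD.
    by rewrite ltNge cd.
  - exists N => // k /= Nk; rewrite -dpE//; apply/ltW/sN => //.
    exact: leq_trans (lef k).
exists u.
  split => //.
  (* The limit is at finite distance from some [s N], which is itself at finite distance from
     [crisp0]. *)
  apply/fuzzy_star_LpE.
  have [N /(_ N (leqnn N)) Nu] := cvgu _ ltr01.
  apply: (le_lt_trans (dp_triangle p1 (v := s N) nu (ns N) (@crisp0_normal R m) su (ss N)
    (@crisp0_usc R m))).
  apply: lte_add_pinfty; first by rewrite dpC (le_lt_trans Nu)// ltry.
  by have [_ _ _ /fuzzy_star_LpE] := Ys N.
apply/fine_cvgP; split.
  have [N uN] := cvgu _ ltr01; exists N => // n /= /uN un.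
  by rewrite ge0_fin_numE ?dp_ge0// (le_lt_trans un)// ltry.
apply/cvgr0Pnorm_lt => e e0.
have e20 : (0 < e / 2)%R by rewrite divr_gt0.
have [N uN] := cvgu _ e20; exists N => // n /= /uN un.
have n0 := dp_ge0 p (s n) u.
rewrite ger0_norm ?fine_ge0// -lte_fin fineK; last first.
  by rewrite ge0_fin_numE// (le_lt_trans un)// ltry.
by rewrite (le_lt_trans un)// lte_fin ltr_pdivrMr// ltr_pMr// ltr1n.
Qed.

End completeness.

Theorem theorem6p7 (R : realType) (m : nat) (p : R)
    (hm : (1 <= m)%N) (hp : 1 <= p) :
  is_completion (@dp R m p) (@Smp R m p) (@Sm R m).
Proof.
split; [exact: Smp_metric|exact: Sm_sub_Smp|exact: Smp_complete|exact: Sm_dense].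
Qed.
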